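(* Let $p,q\ge2$. The horoboundary of the Diestel--Leader graph $\mathrm{DL}(p,q)$ consists of (the classes, modulo additive constants, of) the following functions of $(y,y')\in\mathrm{DL}(p,q)$: - $\rho_\omega(y,y')=d(y,\omega)$, for $\omega\in\partial T$; - $\rho'_{\omega'}(y,y')=d(y',\omega')$, for $\omega'\in\partial T'$; - $\rho_{x_0}(y,y')=-2h(y\wedge x_0)-|h(y)-h(x_0)|=d(y,x_0)-2\max\{h(y),h(x_0)\}$, for $x_0\in T$; - $\rho'_{x_0'}(y,y')=-2h'(y'\wedge x_0')-|h'(y')-h'(x_0')|=d(y',x'_0)-2\max\{h'(y'),h'(x'_0)\}$, for $x_0'\in T'$; - $\rho_i(y,y')=-|h(y)-i|=-|h'(y')+i|$, for $i\in\mathbb Z$.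
   Context: $T,T'$ are the $(p+1)$-regular and $(q+1)$-regular trees with fixed vertices $o,o'$ and fixed ends $\omega_0\in\partial T$, $\omega_0'\in\partial T'$; $\partial T$ is the space of ends. For $u,v\in T$, $u\wedge v$ is the common vertex of the geodesics $uv$, $u\omega_0$, $v\omega_0$, and $h(u)=d(u,u\wedge o)-d(o,u\wedge o)$; $\wedge$ and $h'$ on $T'$ are defined similarly with $o',\omega'_0$. $\mathrm{DL}(p,q)$ has vertex set $\{(v,v')\in T\times T':h(v)+h'(v')=0\}$, with $(v,v')\sim(w,w')$ iff $v\sim w$ in $T$ and $v'\sim w'$ in $T'$; its origin is $(o,o')$ and it has the graph distance. For $\omega\in\partial T$, $d(y,\omega):=\lim_{x\to\omega}(d(y,x)-d(o,x))$ is the horofunction of $\omega$ on $T$, and similarly on $T'$. Horoboundary of a proper metric space $E$: the closure of $\{d(\cdot,x):x\in E\}$ (modulo additive constants) in the space of 1-Lipschitz functions modulo additive constants, with the topology induced by uniform convergence on compact sets (here pointwise convergence), minus $\{d(\cdot,x):x\in E\}$ itself. *)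

(* Defs.v *)
From HB Require Import structures.
From mathcomp Require Import all_boot all_order all_algebra.
From mathcomp Require Import all_classical all_reals all_analysis.

Set Implicit Arguments.
Unset Strict Implicit.
Unset Printing Implicit Defensive.

Import Order.TTheory GRing.Theory Num.Theory.
Import numFieldNormedType.Exports.

Local Open Scope classical_set_scope.
Local Open Scope ring_scope.
Local Open Scope quotient_scope.

Definition walk_length (V : eqType) (e : rel V) (x y : V) : set nat :=
  [set n | exists s : seq V, [/\ path e x s, last x s = y & size s = n]].

(* The default value 0 is only taken when no walk joins [x] to [y]. *)
Definition gdist (V : eqType) (e : rel V) (x y : V) : nat :=
  xget 0%N [set n | walk_length e x y n /\
                    forall m, walk_length e x y m -> (n <= m)%N].

(* [y -- x -- y] is a [ucycle] of length 2, hence the bound in the fourth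
   clause. *)
Definition regular_tree (V : choiceType) (e : rel V) (k : nat) : Prop :=
  [/\ symmetric e, irreflexive e,
      (forall x y, exists2 s, path e x s & last x s = y),
      (forall c : seq V, (2 < size c)%N -> ~ ucycle e c) &
      (forall x, ([set y | e x y] #= `I_k)%card)].

Definition on_geodesic (V : eqType) (e : rel V) (u v w : V) : Prop :=
  exists s : seq V,
    [/\ path e u s, last u s = v, size s = gdist e u v & w \in u :: s].

Definition geodesic_ray (V : eqType) (e : rel V) (r : nat -> V) : Prop :=
  forall m n, (m <= n)%N -> gdist e (r m) (r n) = (n - m)%N.

Definition cofinal_rays (V : Type) (r s : nat -> V) : Prop :=
  exists m n, forall k, r (m + k)%N = s (n + k)%N.

Definition ends (V : eqType) (e : rel V) : set (set (nat -> V)) :=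
  [set w | exists2 r, geodesic_ray e r
                    & w = [set s | geodesic_ray e s /\ cofinal_rays r s]].

(* The vertices of the geodesic from [u] to the end [w]. *)
Definition on_ray (V : Type) (u : V) (w : set (nat -> V)) (x : V) : Prop :=
  exists2 r, w r & r 0%N = u /\ exists n, r n = x.

(* The trace on the vertex set of the neighbourhood filter of the end [w] in
   the end compactification: for [r] in [w], the vertices separated from [r 0]
   by [r n] form a basis. *)
Definition to_end (V : eqType) (e : rel V) (w : set (nat -> V)) :
    set_system V :=
  [set A | exists2 r, w r &
     exists n, [set x | on_geodesic e (r 0%N) x (r n)] `<=` A].

Record marked_graph := MarkedGraph {
  vertex :> choiceType;
  adj : rel vertex;
  origin : vertex;
  end0 : set (nat -> vertex) }.
Arguments adj T : rename, clear implicits.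
Arguments end0 T : rename, clear implicits.

Definition is_marked_regular_tree (k : nat) (T : marked_graph) : Prop :=
  regular_tree (adj T) k /\ ends (adj T) (end0 T).

Definition tdist (T : marked_graph) (u v : T) : nat := gdist (adj T) u v.

(* In a tree this vertex exists and is unique; [origin T] is a dummy default. *)
Definition meet (T : marked_graph) (u v : T) : T :=
  xget (origin T)
    [set w | [/\ on_geodesic (adj T) u v w, on_ray u (end0 T) w
               & on_ray v (end0 T) w]].

Definition height (T : marked_graph) (u : T) : int :=
  (tdist u (meet u (origin T)))%:Z - (tdist (origin T) (meet u (origin T)))%:Z.

(* In a tree the function is eventually constant along [to_end], so that the
   limit exists. *)
Definition end_dist (R : realType) (T : marked_graph)
    (w : set (nat -> T)) (y : T) : R :=
  lim ((fun x => (tdist y x)%:R - (tdist (origin T) x)%:R : R)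
       @ to_end (adj T) w).

Definition DL (T T' : marked_graph) : choiceType :=
  {v : (T * T')%type | height v.1 + height v.2 == 0}.

Definition DL_adj (T T' : marked_graph) : rel (DL T T') :=
  fun v w => adj T (val v).1 (val w).1 && adj T' (val v).2 (val w).2.
Arguments DL_adj T T' : clear implicits.

Definition DL_dist (R : realType) (T T' : marked_graph) (v w : DL T T') : R :=
  (gdist (DL_adj T T') v w)%:R.
Arguments DL_dist R T T' : clear implicits.

(* [d] stands for the distance of a proper metric space.  On 1-Lipschitz
   functions, pointwise convergence coincides with uniform convergence on
   compact sets. *)
Section Horoboundary.
Context {R : realType} {E : choiceType} (d : E -> E -> R).

Definition lipschitz1 : set {ptws E -> R} :=
  [set f | forall x y, `|f x - f y| <= d x y].

Definition eq_up_to_cst (f g : set_type lipschitz1) : bool :=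
  `[< exists c : R, forall x, val f x = val g x + c >].

Lemma eq_up_to_cst_refl : reflexive eq_up_to_cst.
Proof. by move=> f; apply/asboolP; exists 0 => x; rewrite addr0. Qed.

Lemma eq_up_to_cst_sym : symmetric eq_up_to_cst.
Proof.
have H f g : eq_up_to_cst f g -> eq_up_to_cst g f.
  move=> /asboolP[c fg]; apply/asboolP; exists (- c) => x.
  by rewrite fg addrK.
by move=> f g; apply/idP/idP; exact: H.
Qed.

Lemma eq_up_to_cst_trans : transitive eq_up_to_cst.
Proof.
move=> g f h /asboolP[c fg] /asboolP[c' gh]; apply/asboolP.
by exists (c' + c) => x; rewrite fg gh addrA.
Qed.

Canonical eq_up_to_cst_equiv :=
  EquivRel eq_up_to_cst eq_up_to_cst_refl eq_up_to_cst_sym eq_up_to_cst_trans.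

Definition lipschitz1_mod_cst : topologicalType :=
  quotient_topology {eq_quot eq_up_to_cst_equiv}.

Definition cst_class (f : set_type lipschitz1) : lipschitz1_mod_cst :=
  \pi_({eq_quot eq_up_to_cst_equiv}) f.

(* The classes of the members of [A]; functions of [A] that are not
   1-Lipschitz are ignored. *)
Definition cst_classes (A : set (E -> R)) : set lipschitz1_mod_cst :=
  cst_class @` [set f | A (val f)].

Definition distance_functions : set (E -> R) :=
  [set f | exists x, f = fun y => d y x].

Definition horoboundary : set lipschitz1_mod_cst :=
  closure (cst_classes distance_functions) `\` cst_classes distance_functions.

End Horoboundary.
Arguments cst_classes {R E} d A.
Arguments horoboundary {R E} d.

Section Horofunctions.
Variables (R : realType) (T T' : marked_graph).
Implicit Type y : DL T T'.

Definition rho_end (w : set (nat -> T)) y : R := end_dist R w (val y).1.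

Definition rho_end' (w' : set (nat -> T')) y : R := end_dist R w' (val y).2.

Definition rho_vertex (x0 : T) y : R :=
  (- 2 * height (meet (val y).1 x0) - `|height (val y).1 - height x0|)%:~R.

Definition rho_vertex' (x0' : T') y : R :=
  (- 2 * height (meet (val y).2 x0') - `|height (val y).2 - height x0'|)%:~R.

Definition rho_level (i : int) y : R := (- `|height (val y).1 - i|)%:~R.

Definition DL_horofunctions : set (DL T T' -> R) :=
  [set f | [\/ exists2 w, ends (adj T) w & f = rho_end w,
               exists2 w', ends (adj T') w' & f = rho_end' w',
               exists x0 : T, f = rho_vertex x0 |
               (exists x0' : T', f = rho_vertex' x0') \/
               (exists i : int, f = rho_level i)]].

End Horofunctions.
Arguments DL_horofunctions R T T' : clear implicits.

(* Main.v *)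
(** The distance of [DL(p,q)] is [d(v,w) + d(v',w') - |h v - h w|], that is
    [-2 h(v/\w) - 2 h'(v'/\w') - |h v - h w|].  Distances being integers, a
    limit of distance functions modulo constants is a function [f] such that,
    along some filter of vertices [x], each difference [f y - f z] eventually
    equals [d(y,x) - d(z,x)]; the filter may be taken to be an ultrafilter.
    Along it, [h x] is constant or tends to [+oo] or [-oo].  If [h x] is
    constant, each coordinate of [x] is either constant or escapes, in which
    case its meet with [y] no longer depends on [y]: this gives [rho_x0],
    [rho'_x0'], [rho_i], or a distance function when both are constant.  If
    [h x] tends to [+oo], only the first coordinate matters and, balls being
    finite, it converges to an end; [-oo] is symmetric.  Conversely each of
    these limits is realised by explicit sequences, and all horofunctions are
    unbounded below while distance functions are not. *)
Require Import Defs.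
From HB Require Import structures.
From mathcomp Require Import all_boot all_order all_algebra.
From mathcomp Require Import all_classical all_reals all_analysis.
From mathcomp Require Import zify lra.

Set Implicit Arguments.
Unset Strict Implicit.
Unset Printing Implicit Defensive.

Import Order.TTheory GRing.Theory Num.Theory.
Import numFieldNormedType.Exports.

Local Open Scope classical_set_scope.
Local Open Scope ring_scope.
Local Open Scope quotient_scope.

(** * Graph distance and trees *)

Lemma set_nat_min (A : set nat) : A !=set0 ->
  exists n, A n /\ forall m, A m -> (n <= m)%N.
Proof.
move=> [k Ak]; have exA : exists n, `[< A n >] by exists k; apply/asboolP.
exists (ex_minn exA); case: ex_minnP => n /asboolP An nmin; split=> // m Am.
by apply: nmin; apply/asboolP.
Qed.

Section GraphDistance.
Context {V : eqType} (e : rel V).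
Local Notation d := (gdist e).

Lemma gdist_min x y n : walk_length e x y n ->
  walk_length e x y (d x y) /\ (d x y <= n)%N.
Proof.
move=> xyn; have [m mP] := set_nat_min (ex_intro _ n xyn).
have [w wmin] : [set k | walk_length e x y k /\
    forall m, walk_length e x y m -> (k <= m)%N] (d x y).
  by apply: xgetPex; exists m.
by split=> //; exact: wmin.
Qed.

Lemma gdist_le x s : path e x s -> (d x (last x s) <= size s)%N.
Proof. by move=> xs; have [] := @gdist_min x (last x s) (size s); first by exists s. Qed.

Lemma gdistxx x : d x x = 0%N.
Proof. by apply/eqP; rewrite -leqn0; exact: (@gdist_le x [::]). Qed.

Lemma potential_walk (F : V -> nat) w : F w = 0%N ->
    (forall x, x != w -> exists2 y, e x y & F x = (F y).+1) ->
  forall x, walk_length e x w (F x).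
Proof.
move=> Fw Fdesc x; have [n] := ubnP (F x); elim: n x => // n IH x.
have [-> _|xw Fx] := eqVneq x w; first by exists [::]; rewrite Fw.
have [y exy Fxy] := Fdesc _ xw.
have [|s [ys sw sF]] := IH y; first by rewrite -Fxy.
by exists (y :: s); rewrite /= exy ys sF Fxy.
Qed.

(** The edge condition bounds [F x] by the length of every walk from [x] to [w], and the descent
    condition produces a walk of exactly that length. This is the tool for computing the distance of
    the Diestel-Leader graph. *)
Lemma gdist_potential (F : V -> nat) w : F w = 0%N ->
    (forall x y, e x y -> (F x <= (F y).+1)%N) ->
    (forall x, x != w -> exists2 y, e x y & F x = (F y).+1) ->
  forall x, gdist e x w = F x.
Proof.
move=> Fw F1 Fdesc x; have [s [xs sw sF]] := potential_walk Fw Fdesc x.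
have [[t [xt tw <-]] le] := gdist_min (ex_intro _ s (And3 xs sw sF)).
apply/eqP; rewrite eqn_leq le -sF sF andTb {le s xs sw sF}.
elim: t x xt tw => [|y t IH] x /=; first by move=> _ ->; rewrite Fw.
by case/andP=> /F1 Fxy yt tw; rewrite (leq_trans Fxy)// ltnS IH.
Qed.

Hypothesis esym : symmetric e.
Hypothesis econn : forall x y, exists2 s, path e x s & last x s = y.

Lemma gdist_walk x y : exists s, [/\ path e x s, last x s = y & size s = d x y].
Proof.
have [s xs sy] := econn x y.
by have [] := gdist_min (ex_intro _ s (And3 xs sy erefl)).
Qed.

Lemma gdistC x y : d x y = d y x.
Proof.
suff le u v : (d u v <= d v u)%N by apply/eqP; rewrite eqn_leq !le.
have [s [vs su <-]] := gdist_walk v u.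
have := @gdist_le u (rev (belast v s)).
rewrite -{1}su rev_path (@eq_path _ _ e)//.
move=> /(_ vs); rewrite size_rev size_belast => /(leq_trans _); apply.
suff -> : last u (rev (belast v s)) = v by [].
case: s vs su => [|a s] //= _ _.
by rewrite rev_cons last_rcons.
Qed.

Lemma gdist_triangle y x z : (d x z <= d x y + d y z)%N.
Proof.
have [s [xs sy <-]] := gdist_walk x y; have [t [yt tz <-]] := gdist_walk y z.
have := @gdist_le x (s ++ t); rewrite cat_path xs sy yt last_cat sy tz size_cat.
exact.
Qed.

Lemma gdist_edge x y : e x y -> (d x y <= 1)%N.
Proof. by move=> exy; apply: (@gdist_le x [:: y]); rewrite /= exy. Qed.

Lemma gdist_edge_le x y z : e x y -> (d x z <= (d y z).+1)%N.
Proof.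
by move=> /gdist_edge xy; have := gdist_triangle y x z; lia.
Qed.

Lemma gdist0_eq x y : d x y = 0%N -> x = y.
Proof. by have [[|? ?] [_ sy]] := gdist_walk x y; move=> //= <-. Qed.

Lemma gdist_step x z n : d x z = n.+1 -> exists2 y, e x y & d y z = n.
Proof.
have [[|y s] [/= + sz sn]] := gdist_walk x z; first by rewrite -sn.
case/andP=> exy ys dn; exists y => //.
have := gdist_edge_le z exy; have := @gdist_le y s ys; rewrite sz.
by move: sn; rewrite dn; lia.
Qed.

Lemma on_geodesicE u v w : on_geodesic e u v w <-> (d u w + d w v = d u v)%N.
Proof.
split=> [[s [us sv suv ws]]|uwv].
  have := gdist_triangle w u v; move: us sv suv.
  case/splitPl: ws => s1 s2 s1w.
  rewrite cat_path last_cat size_cat s1w => /andP[us1 ws2] s2v suv.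
  have := gdist_le us1; have := gdist_le ws2; rewrite s1w s2v; lia.
have [s [us sw sn]] := gdist_walk u w; have [t [wt tv tn]] := gdist_walk w v.
exists (s ++ t); rewrite cat_path us sw wt last_cat sw tv size_cat sn tn uwv.
by split=> //; rewrite -cat_cons mem_cat -sw mem_last.
Qed.

End GraphDistance.

(** * Separation by a vertex in a tree *)

Section Tree.
Context {V : eqType} (e : rel V).
Hypothesis esym : symmetric e.
Hypothesis eirr : irreflexive e.
Hypothesis econn : forall x y, exists2 s, path e x s & last x s = y.
Hypothesis eacyc : forall c : seq V, (2 < size c)%N -> ~ ucycle e c.
Local Notation d := (gdist e).

(** Being in the same component once [x] is removed. *)
Definition joined_avoiding x a b :=
  exists2 s, path e a s /\ last a s = b & x \notin a :: s.

Lemma joined_avoiding_sym x a b : joined_avoiding x a b -> joined_avoiding x b a.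
Proof.
move=> [s [as_ sb] xs]; exists (rev (belast a s)); last first.
  by rewrite -sb -rev_rcons -lastI mem_rev.
rewrite -sb rev_path (@eq_path _ _ e)//.
split=> //; case: s as_ sb xs => [|c s] //= _ _ _.
by rewrite rev_cons last_rcons.
Qed.

Lemma joined_avoiding_trans x a b c :
  joined_avoiding x a b -> joined_avoiding x b c -> joined_avoiding x a c.
Proof.
move=> [s [as_ sb] xs] [t [bt tc] xt]; exists (s ++ t).
  by rewrite cat_path last_cat as_ sb bt tc.
rewrite -cat_cons mem_cat negb_or xs.
by move: xt; rewrite inE negb_or => /andP[].
Qed.

(** If [a] and [b] were distinct, a simple path between them avoiding [x] would close up through [x]
    into a cycle. *)
Lemma joined_avoiding_nbr x a b :
  e x a -> e x b -> joined_avoiding x a b -> a = b.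
Proof.
move=> exa exb [s [as_ sb] xs]; apply/eqP/negP => /negP ab.
move: sb; case/shortenP: as_ => t at_ ut ts tb.
apply: (eacyc (c := x :: a :: t)).
  by case: t tb {at_ ut ts} => //= ab'; rewrite ab' eqxx in ab.
rewrite /ucycle cons_uniq ut andbT /= exa rcons_path at_ tb esym exb /=.
move: xs; rewrite !inE !negb_or => /andP[-> xs] /=.
by apply: contra xs => /ts.
Qed.

(** A geodesic from [a] to [z] passing through [x] would make [x] strictly closer to [z] than
    [a]. *)
Lemma closer_joined_avoiding x a z :
  (d a z <= d x z)%N -> a != x -> joined_avoiding x a z.
Proof.
move=> az ax; have [s [as_ sz sn]] := gdist_walk econn a z.
exists s => //; rewrite inE eq_sym negb_or ax /=; apply/negP.
move=> xs; move: as_ sz sn; case/splitPr: xs => s1 s2.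
rewrite cat_path last_cat size_cat /= => /and3P[_ _ xs2] s2z.
have := gdist_le xs2; rewrite s2z; lia.
Qed.

Lemma closer_unique x a b z : e x a -> e x b ->
  (d a z < d x z)%N -> (d b z < d x z)%N -> a = b.
Proof.
have ne c : e x c -> c != x.
  by move=> exc; apply/eqP => cx; rewrite cx eirr in exc.
move=> exa exb az bz; apply: (@joined_avoiding_nbr x) => //.
apply: (@joined_avoiding_trans _ _ z).
  by apply: closer_joined_avoiding; [exact: ltnW|exact: ne].
apply: joined_avoiding_sym.
by apply: closer_joined_avoiding; [exact: ltnW|exact: ne].
Qed.

Lemma gdist_edge_neq x y z : e x y -> d x z <> d y z.
Proof.
move=> exy xyz; case yz : (d y z) => [|n].
  move: exy; rewrite (gdist0_eq econn yz) (gdist0_eq econn (etrans xyz yz)).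
  by rewrite eirr.
have [a eya az] := gdist_step econn yz.
have eyx : e y x by rewrite esym.
have ne c : e y c -> c != y.
  by move=> exc; apply/eqP => cx; rewrite cx eirr in exc.
(* At equal distances, [x] and the neighbour [a] of [y] closer to [z] both reach [z] without passing
   through [y]. *)
have xa : x = a.
  apply: (joined_avoiding_nbr eyx eya); apply: (@joined_avoiding_trans _ _ z).
    by apply: closer_joined_avoiding; [rewrite xyz|exact: ne].
  apply: joined_avoiding_sym; apply: closer_joined_avoiding; last exact: ne.
  by rewrite az yz.
by move: xyz; rewrite xa az yz => /eqP; rewrite ltn_eqF.
Qed.

Lemma gdist_edgeVS x y z : e x y -> d x z = (d y z).+1 \/ d y z = (d x z).+1.
Proof.
move=> exy; have := gdist_edge_neq (z := z) exy.
have := gdist_edge_le econn z exy; rewrite esym in exy.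
by have := gdist_edge_le econn z exy; lia.
Qed.

(* A walk that does not turn back at any vertex is a geodesic. *)
Lemma gdist_split y a b x : e a b -> d y b = (d y a).+1 ->
  d a x = (d b x).+1 -> (d y x = d y b + d b x)%N.
Proof.
have [n] := ubnP (d b x); elim: n a b => // n IH a b bxn eab yb ax.
case bx : (d b x) => [|m]; first by rewrite (gdist0_eq econn bx) addn0.
have [c ebc cx] := gdist_step econn bx.
have eba : e b a by rewrite esym.
(* Otherwise [a] and [c] are both neighbours of [b] closer to [y], hence equal, although [c] is
   closer to [x] than [b] and [a] is farther. *)
have yc : d y c = (d y b).+1.
  have [|yc] := gdist_edgeVS y ebc; last by rewrite gdistC// yc gdistC.
  rewrite ![d _ y]gdistC// => yc; suff ca : c = a by rewrite ca ax bx in cx; lia.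
  apply: (closer_unique ebc eba (z := y)); rewrite ![d _ y]gdistC//; lia.
by rewrite (IH b c) ?cx ?yc ?bx//; lia.
Qed.

End Tree.

(** * Busemann functions, parents and heights *)

(* [d(y, r n) - n] is eventually constant in [n]. *)
Definition busemann (V : eqType) (e : rel V) (r : nat -> V) (y : V) : int :=
  xget 0 [set c | exists N, forall n, (N <= n)%N ->
    (gdist e y (r n))%:Z = c + n%:Z].

Section MarkedTree.
Context {k : nat} {T : marked_graph}.
Hypothesis hT : is_marked_regular_tree k T.
Local Notation e := (adj T).
Local Notation d := (@tdist T).
Local Notation o := (origin T).
Local Notation w0 := (end0 T).
Implicit Types u v x y z : T.

Lemma adjC u v : e u v = e v u. Proof. by have [[-> _ _ _ _] _] := hT. Qed.

Lemma adjxx u : e u u = false. Proof. by have [[_ -> _ _ _] _] := hT. Qed.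

Lemma adj_connected u v : exists2 s, path e u s & last u s = v.
Proof. by have [[_ _ + _ _] _] := hT; apply. Qed.

Lemma end0_end : ends e w0. Proof. by case: hT. Qed.

Lemma tdistC u v : d u v = d v u.
Proof. by apply: gdistC; [exact: adjC|exact: adj_connected]. Qed.

Lemma tdistxx u : d u u = 0%N. Proof. exact: gdistxx. Qed.

Lemma tdist_triangle v u x : (d u x <= d u v + d v x)%N.
Proof. by apply: gdist_triangle; exact: adj_connected. Qed.

Lemma tdist_adj u v : e u v -> d u v = 1%N.
Proof.
move=> uv; apply/eqP; rewrite eqn_leq gdist_edge// lt0n; apply/eqP.
by move=> /(gdist0_eq adj_connected) eq; rewrite eq adjxx in uv.
Qed.

Lemma tdist_adjVS u v z : e u v -> d u z = (d v z).+1 \/ d v z = (d u z).+1.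
Proof.
have [[? ? ? ? _] _] := hT; by move=> uv; apply: gdist_edgeVS.
Qed.

Lemma tdist_step u z n : d u z = n.+1 -> exists2 v, e u v & d v z = n.
Proof. by apply: gdist_step; exact: adj_connected. Qed.

Lemma tdist_closer_unique u a b z : e u a -> e u b ->
  (d a z < d u z)%N -> (d b z < d u z)%N -> a = b.
Proof. by have [[? ? ? ? _] _] := hT; apply: closer_unique. Qed.

Lemma tdist_split y a b x : e a b -> d y b = (d y a).+1 ->
  d a x = (d b x).+1 -> (d y x = d y b + d b x)%N.
Proof. by have [[? ? ? ? _] _] := hT; apply: gdist_split. Qed.

Lemma on_geodesic_tdist u v x : on_geodesic e u v x <-> (d u x + d x v = d u v)%N.
Proof. by apply: on_geodesicE; exact: adj_connected. Qed.

Section Ray.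
Variable r : nat -> T.
Hypothesis rray : geodesic_ray e r.
Local Notation B := (busemann e r).

Lemma ray_dist m n : (m <= n)%N -> d (r m) (r n) = (n - m)%N.
Proof. exact: rray. Qed.

(** By the triangle inequality [d y (r n) - n] is nonincreasing in [n] and at least [- d y (r 0)],
    so it is constant from the point where it reaches its minimum. Adding [d y (r 0)] keeps it a
    natural number. *)
Lemma busemannP y : exists N, forall n, (N <= n)%N -> (d y (r n))%:Z = B y + n%:Z.
Proof.
suff: [set c : int | exists N, forall n, (N <= n)%N -> (d y (r n))%:Z = c + n%:Z] !=set0.
  by move=> /(xgetPex 0).
have lb n : (n <= d y (r n) + d y (r 0%N))%N.
  have := tdist_triangle y (r 0%N) (r n); rewrite ray_dist// subn0 [d (r _) y]tdistC; lia.
have [_ [[N _ <-] Nmin]] := @set_nat_min [set (d y (r n) + d y (r 0%N) - n)%N | n in setT]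
  (ex_intro _ _ (imageT _ 0%N)).
exists ((d y (r N))%:Z - N%:Z); exists N => n Nn.
have := Nmin _ (imageT _ n); have := tdist_triangle (r N) y (r n).
rewrite ray_dist//; have := lb N; have := lb n; lia.
Qed.

Lemma busemann_eq c y N :
  (forall n, (N <= n)%N -> (d y (r n))%:Z = c + n%:Z) -> B y = c.
Proof.
move=> yc; have [M yB] := busemannP y.
by have := yc _ (leq_maxr M N); rewrite yB ?leq_maxl//; lia.
Qed.

Lemma busemann_adj x y : e x y -> B x = B y + 1 \/ B y = B x + 1.
Proof.
move=> xy; have [M xB] := busemannP x; have [N yB] := busemannP y.
have := tdist_adjVS (r (maxn M N)) xy.
by have := xB _ (leq_maxl M N); have := yB _ (leq_maxr M N); lia.
Qed.

(** Far along the ray, a smaller Busemann value is a smaller distance to [r n]. *)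
Lemma busemann_lower_unique x a b : e x a -> e x b -> B a < B x -> B b < B x -> a = b.
Proof.
move=> xa xb ax bx; have [L xB] := busemannP x.
have [M aB] := busemannP a; have [N bB] := busemannP b.
have [n [Ln Mn Nn]] : exists n, [/\ (L <= n)%N, (M <= n)%N & (N <= n)%N].
  by exists (L + M + N)%N; split; lia.
by apply: (tdist_closer_unique (z := r n) xa xb);
  have := xB _ Ln; have := aB _ Mn; have := bB _ Nn; lia.
Qed.

(** The neighbour is the first step of a geodesic to a far vertex [r n]; taking [n] larger than the
    absolute value of [B x] makes that geodesic nonempty. *)
Lemma busemann_lower x : exists2 y, e x y & B y = B x - 1.
Proof.
have [L xB] := busemannP x.
have [n [Ln xn]] : exists n, (L <= n)%N /\ (0 < d x (r n))%N.
  by exists (L + `|B x|.+1)%N; have := xB (L + `|B x|.+1)%N; split; lia.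
have [y xy yn] := @tdist_step x (r n) (d x (r n)).-1 (esym (prednK xn)).
exists y => //; have := busemann_adj xy; have := xB _ Ln.
have [N yB] := busemannP y; have := yB _ (leq_maxr n N).
have := tdist_triangle (r n) y (r (maxn n N)); rewrite ray_dist ?leq_maxl//.
by have := leq_maxl n N; lia.
Qed.

Lemma busemann_lip x y : `|B x - B y| <= (d x y)%:Z.
Proof.
have [M xB] := busemannP x; have [N yB] := busemannP y.
have := xB _ (leq_maxl M N); have := yB _ (leq_maxr M N).
have := tdist_triangle y x (r (maxn M N)); have := tdist_triangle x y (r (maxn M N)).
by rewrite [d y x]tdistC; lia.
Qed.

Lemma busemann_ray n : B (r n) = - n%:Z.
Proof. by apply: (@busemann_eq _ _ n) => m nm; rewrite ray_dist//; lia. Qed.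

Lemma ray_adj n : e (r n) (r n.+1).
Proof.
have := ray_dist (leqnSn n); rewrite subSnn => /tdist_step[v nv].
by move=> /(gdist0_eq adj_connected) <-.
Qed.

(* Once the ray moves away from [y] it does so forever. *)
Lemma busemann_beyond y : exists2 N, (0 < N)%N & forall n x, (N <= n)%N ->
  (d (r 0%N) (r n) + d (r n) x = d (r 0%N) x)%N -> (d y x)%:Z = B y + (d (r 0%N) x)%:Z.
Proof.
have [N yB] := busemannP y; exists N.+1 => // -[//|n x]; rewrite ltnS => Nn rnx.
have ynS := yB _ (leqW Nn); have yn := yB _ Nn.
have := @tdist_split y (r n) (r n.+1) x (ray_adj n); rewrite !ray_dist// subn0 in rnx *.
have := tdist_triangle (r n) (r 0%N) x; rewrite ray_dist// subn0.
have := tdist_adjVS x (ray_adj n); lia.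
Qed.

End Ray.

Lemma cofinal_rays_sym (r s : nat -> T) : cofinal_rays r s -> cofinal_rays s r.
Proof. by move=> [m [n rs]]; exists n, m. Qed.

Lemma cofinal_rays_trans (r s t : nat -> T) :
  cofinal_rays r s -> cofinal_rays s t -> cofinal_rays r t.
Proof.
move=> [m [n rs]] [a [b st]]; exists (m + a)%N, (b + n)%N => i.
by rewrite -addnA rs [(n + _)%N]addnCA st addnA.
Qed.

Lemma end_ray w : ends e w -> exists r, w r.
Proof. by move=> [r rray ->]; exists r; split=> //; exists 0%N, 0%N. Qed.

Lemma end_geodesic w r : ends e w -> w r -> geodesic_ray e r.
Proof. by move=> [? _ ->] []. Qed.

Lemma end_cofinal w r s : ends e w -> w r -> w s -> cofinal_rays r s.
Proof.
by move=> [t _ ->] [_ tr] [_ ts]; apply: cofinal_rays_trans ts; exact: cofinal_rays_sym.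
Qed.

Lemma end_mem w r s : ends e w -> w r -> geodesic_ray e s -> cofinal_rays r s -> w s.
Proof.
by move=> [t _ ->] [_ tr] sray rs; split=> //; exact: cofinal_rays_trans rs.
Qed.

Lemma busemann_cofinal r s : geodesic_ray e r -> geodesic_ray e s ->
  cofinal_rays r s -> exists c : int, forall y, busemann e s y = busemann e r y + c.
Proof.
move=> rray sray [m [n rs]]; exists (m%:Z - n%:Z) => y.
have [N yB] := busemannP rray y.
apply: (@busemann_eq _ sray _ _ (n + N)%N) => i Ni.
have := yB (m + (i - n))%N; rewrite rs subnKC; lia.
Qed.

End MarkedTree.

Definition ray0 (T : marked_graph) : nat -> T := xget (fun=> origin T) (end0 T).

(** The next vertex after [u] on the geodesic to the reference end. The tree becomes genealogical:
    ancestors are the iterates of [par], and heights decrease towards the end. *)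
Definition par {T : marked_graph} (u : T) : T :=
  xget u [set v | adj T u v /\ busemann (adj T) (ray0 T) v < busemann (adj T) (ray0 T) u].

Section Parent.
Context {k : nat} {T : marked_graph}.
Hypothesis hT : is_marked_regular_tree k T.
Local Notation e := (adj T).
Local Notation d := (@tdist T).
Local Notation o := (origin T).
Local Notation w0 := (end0 T).
Local Notation h := (@height T).
Local Notation B := (busemann e (ray0 T)).
Implicit Types u v x y z : T.

Lemma ray0_end0 : w0 (ray0 T).
Proof. by have [r w0r] := end_ray (end0_end hT); exact: (xgetPex _ (ex_intro _ r w0r)). Qed.

Lemma ray0_ray : geodesic_ray e (ray0 T).
Proof. exact: end_geodesic (end0_end hT) ray0_end0. Qed.

Lemma par_spec u : e u (par u) /\ B (par u) = B u - 1.
Proof.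
have [v uv vu] := busemann_lower hT ray0_ray u.
have [upu] : [set v | e u v /\ B v < B u] (par u).
  by apply: xgetPex; exists v; split=> //; lia.
by have := busemann_adj hT ray0_ray upu; split=> //; lia.
Qed.

Lemma par_adj u : e u (par u). Proof. by have [] := par_spec u. Qed.

Lemma adj_par_r u : e (par u) u. Proof. by rewrite (adjC hT) par_adj. Qed.

Lemma par_unique u v : e u v -> B v < B u -> v = par u.
Proof.
have [upu pu] := par_spec u => uv vu.
by apply: (busemann_lower_unique hT ray0_ray uv upu); lia.
Qed.

Lemma adj_par u v : e u v <-> v = par u \/ u = par v.
Proof.
split=> [uv|[]->]; [|exact: par_adj|by rewrite (adjC hT); exact: par_adj].
have [uB|vB] := busemann_adj hT ray0_ray uv.
  by left; apply: par_unique => //; lia.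
by right; apply: par_unique; [rewrite (adjC hT)|lia].
Qed.

Lemma busemann_iter_par n u : B (iter n par u) = B u - n%:Z.
Proof.
by elim: n => [|n IH] /=; [lia|have [_ ->] := par_spec (iter n par u); lia].
Qed.

Lemma tdist_iter_par n u : d u (iter n par u) = n.
Proof.
apply/eqP; rewrite eqn_leq; apply/andP; split; last first.
  by have := busemann_lip hT ray0_ray u (iter n par u); rewrite busemann_iter_par; lia.
elim: n => [|n IH]; first by rewrite tdistxx.
have := tdist_triangle hT (iter n par u) u (iter n.+1 par u).
by rewrite [d (iter n _ _) _](tdist_adj hT) /=; [lia|exact: par_adj].
Qed.

Lemma iter_par_ray u : geodesic_ray e (fun n => iter n par u).
Proof.
move=> m n mn; rewrite -{1}(subnK mn) iterD; exact: tdist_iter_par.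
Qed.

(** Cofinal rays have Busemann functions differing by a constant, so the value drops by one at each
    step of [r], and only the parent has a smaller value. *)
Lemma end0_iter_par r n : w0 r -> r n = iter n par (r 0%N).
Proof.
move=> w0r; have rray := end_geodesic (end0_end hT) w0r.
have [c rc] := busemann_cofinal hT ray0_ray rray (end_cofinal (end0_end hT) ray0_end0 w0r).
elim: n => // n IH; rewrite iterS -IH; apply: par_unique; first exact: (ray_adj hT).
have := busemann_ray hT rray n; have := busemann_ray hT rray n.+1; rewrite !rc; lia.
Qed.

Lemma common_ancestor u v : exists n m, iter n par u = iter m par v.
Proof.
have [s us <-] := adj_connected hT u v; elim: s u us => [|a s IH] u /=.
  by exists 0%N, 0%N.
case/andP=> /adj_par ua /IH[n [m nm]]; case: ua => [au|->].
  by exists n.+1, m; rewrite iterSr -au.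
case: n nm => [|n] nm; first by exists 0%N, m.+1; rewrite [LHS]/= iterS -nm.
exists n.+2, m.+2; rewrite /= in nm *; congr par; rewrite -nm.
by rewrite -!iterS !iterSr.
Qed.

Lemma end0_par u : w0 (fun n => iter n par u).
Proof.
apply: (end_mem (end0_end hT) ray0_end0 (iter_par_ray u)).
have [n [m nm]] := common_ancestor (ray0 T 0%N) u.
exists n, m => i; rewrite end0_iter_par ?[(_ + i)%N]addnC ?iterD ?nm//.
exact: ray0_end0.
Qed.

Lemma on_ray_par u x : on_ray u w0 x <-> exists n, x = iter n par u.
Proof.
split=> [[r w0r [r0 [n <-]]]|[n ->]].
  by exists n; rewrite -r0; exact: end0_iter_par.
by exists (fun n => iter n par u); [exact: end0_par|split=> //; exists n].
Qed.

(** The path from [u] to the common ancestor and on to [v] does not turn back there, so it is a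
    geodesic. *)
Lemma iter_par_fork u v n m :
  iter n.+1 par u = iter m.+1 par v -> iter n par u != iter m par v ->
  d u v = (n.+1 + m.+1)%N.
Proof.
move=> nm neq; set w := iter n.+1 par u.
have wv : d w v = m.+1 by rewrite /w nm (tdistC hT) tdist_iter_par.
have uw : d u w = n.+1 by exact: tdist_iter_par.
rewrite (@tdist_split _ _ hT u (iter n par u) w v) ?uw ?wv ?tdist_iter_par//.
  exact: par_adj.
have [->|awS] := tdist_adjVS hT v (par_adj (iter n par u)); first by rewrite -wv.
case/eqP: neq; apply: (tdist_closer_unique hT (u := w) (z := v)).
- by rewrite (adjC hT); exact: par_adj.
- by rewrite /w nm (adjC hT); exact: par_adj.
- by rewrite /w /= awS.
- by rewrite (tdistC hT) tdist_iter_par wv.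
Qed.

(** The first ancestor of [u] that is also an ancestor of [v] satisfies the conditions defining
    [meet], so the default is not taken. Minimality gives the fork required by [iter_par_fork]. *)
Lemma meet_spec u v : exists n m,
  [/\ iter n par u = meet u v, iter m par v = meet u v & d u v = (n + m)%N].
Proof.
suff [n [m [nm uv]]] : exists n m, iter n par u = iter m par v /\ d u v = (n + m)%N.
  have: [set x | [/\ on_geodesic e u v x, on_ray u w0 x & on_ray v w0 x]] (meet u v).
    apply: xgetPex; exists (iter n par u); split.
    - apply/(on_geodesic_tdist hT); rewrite {2}nm uv tdist_iter_par.
      by rewrite [d _ v](tdistC hT) tdist_iter_par.
    - by apply/on_ray_par; exists n.
    - by apply/on_ray_par; exists m.
  case=> /(on_geodesic_tdist hT) uxv /on_ray_par[a xa] /on_ray_par[b xb].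
  exists a, b; split=> //; rewrite -uxv {1}xa xb tdist_iter_par.
  by rewrite [d _ v](tdistC hT) tdist_iter_par.
have [n [[m nm] nmin]] := @set_nat_min
  [set n | exists m, iter n par u = iter m par v] (common_ancestor u v).
exists n, m; split=> //; case: n nm nmin => [|n] nm nmin.
  by rewrite /= in nm; rewrite nm (tdistC hT) tdist_iter_par.
case: m nm => [|m] nm; first by rewrite -[v]/(iter 0 par v) -nm tdist_iter_par addn0.
apply: iter_par_fork => //; apply/eqP => eq.
by have := nmin n (ex_intro _ m eq); rewrite ltnn.
Qed.

(** Both distances in the definition of [height] are drops of the Busemann function down to the
    meet. *)
Lemma height_busemann u : h u = B u - B o.
Proof.
rewrite /height; have [n [m [nE mE _]]] := meet_spec u o.
have := busemann_iter_par n u; have := busemann_iter_par m o.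
by rewrite -{1}nE -mE !tdist_iter_par nE mE; lia.
Qed.

Lemma height_origin : h o = 0. Proof. by rewrite height_busemann subrr. Qed.

Lemma height_par u : h (par u) = h u - 1.
Proof. by rewrite !height_busemann; have [_ ->] := par_spec u; lia. Qed.

Lemma height_iter_par n u : h (iter n par u) = h u - n%:Z.
Proof. by rewrite !height_busemann busemann_iter_par; lia. Qed.

Lemma tdist_height u v : (d u v)%:Z = h u + h v - 2 * h (meet u v).
Proof.
have [n [m [nE mE ->]]] := meet_spec u v.
by have := height_iter_par n u; have := height_iter_par m v; rewrite nE mE; lia.
Qed.

Lemma tmeetC u v : meet u v = meet v u.
Proof.
have geoC a b x : on_geodesic e a b x -> on_geodesic e b a x.
  move=> /(on_geodesic_tdist hT) axb; apply/(on_geodesic_tdist hT).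
  by rewrite (tdistC hT b x) (tdistC hT x a) (tdistC hT b a) addnC.
rewrite /meet; congr xget; apply/seteqP.
by split=> x [/geoC ? ? ?].
Qed.

End Parent.

(** * Heights of meets, finiteness of balls, and branching *)

Section Meet.
Context {k : nat} {T : marked_graph}.
Hypothesis hT : is_marked_regular_tree k T.
Local Notation e := (adj T).
Local Notation d := (@tdist T).
Local Notation o := (origin T).
Local Notation h := (@height T).
Implicit Types u v x y z : T.

(** The meet is the highest common ancestor: a path through any other one obeys the triangle
    inequality. *)
Lemma meet_ge u v n m : iter n par u = iter m par v -> h u - n%:Z <= h (meet u v).
Proof.
move=> nm; have := tdist_triangle hT (iter n par u) u v; rewrite {2}nm.
rewrite (tdistC hT (iter m _ _)) !(tdist_iter_par hT).
have := tdist_height hT u v; have := height_iter_par hT n u.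
by have := height_iter_par hT m v; rewrite -nm; lia.
Qed.

Lemma meet_attained u v : exists n m, iter n par u = iter m par v /\
  h (meet u v) = h u - n%:Z /\ h (meet u v) = h v - m%:Z.
Proof.
have [n [m [nE mE _]]] := meet_spec hT u v; exists n, m.
by rewrite -{1}(height_iter_par hT) -(height_iter_par hT) nE mE.
Qed.

Lemma meet_le u v : h (meet u v) <= h u.
Proof. by have [n [m [_ []]]] := meet_attained u v; lia. Qed.

Lemma meet_le_r u v : h (meet u v) <= h v.
Proof. by rewrite (tmeetC hT) meet_le. Qed.

Lemma meet_xx u : h (meet u u) = h u.
Proof.
apply/eqP; rewrite eq_le meet_le/=.
by have := @meet_ge u u 0%N 0%N erefl; rewrite subr0.
Qed.

(** An ultrametric inequality: of the two meets, both ancestors of [v], the lower is an ancestor of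
    the other, hence common to [u] and [x]. *)
Lemma meet_ultra (c : int) u v x :
  c <= h (meet u v) -> c <= h (meet v x) -> c <= h (meet u x).
Proof.
have [n [m [nm [hn hm]]]] := meet_attained u v.
have [a [b [ab [ha hb]]]] := meet_attained v x => cu cx.
case: (leqP m a) => ma.
  have eq : iter (a - m + n) par u = iter b par x by rewrite iterD nm -iterD subnK.
  have := meet_ge eq; have := meet_attained u x; lia.
have eq : iter n par u = iter (m - a + b) par x.
  by rewrite nm iterD -ab -iterD subnK// ltnW.
by have := meet_ge eq; lia.
Qed.

Lemma meet_ultra_eq u v x : h (meet u v) < h (meet v x) -> h (meet u x) = h (meet u v).
Proof.
move=> lt; apply/eqP; rewrite eq_le; apply/andP; split; last first.
  by apply: (@meet_ultra _ _ v); [|exact: ltW].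
rewrite leNgt; apply/negP => lt'.
suff : h (meet u v) + 1 <= h (meet u v) by lia.
by apply: (@meet_ultra _ u x v); [|rewrite (tmeetC hT x)]; lia.
Qed.

(** Replacing [u] by its parent moves the meet only when [u] is itself an ancestor of [v], the case
    treated in [meet_par_eq]. *)
Lemma meet_par_lt u v : h (meet u v) < h u -> h (meet (par u) v) = h (meet u v).
Proof.
move=> lt; have [n [m [nm [hn hm]]]] := meet_attained u v.
have [a [b [ab [ha hb]]]] := meet_attained (par u) v.
rewrite -iterSr in ab; have := meet_ge ab.
case: n hn nm => [|n] hn nm; first lia.
rewrite iterSr in nm; have := meet_ge nm; rewrite (height_par hT) in ha *; lia.
Qed.

Lemma meet_par_eq u v : h (meet u v) = h u -> h (meet (par u) v) = h u - 1.
Proof.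
move=> eq; have [[|n] [m [nm [hn hm]]]] := meet_attained u v; last lia.
have := meet_le (par u) v; rewrite (height_par hT).
have pum : par u = iter m.+1 par v by rewrite iterS -nm.
by have := @meet_ge (par u) v 0%N m.+1 pum; rewrite (height_par hT); lia.
Qed.

Lemma meet_eq_height u v : h (meet u v) = h u -> exists2 m, u = iter m par v & h u = h v - m%:Z.
Proof.
move=> eq; have [n [m [nm [hn hm]]]] := meet_attained u v.
have n0 : n = 0%N by lia.
by rewrite n0 in nm; exists m => //; rewrite -eq hm.
Qed.

Lemma finite_nbrs u : finite_set [set v | e u v].
Proof. by have [[_ _ _ _ /(_ u) ku] _] := hT; exists k. Qed.

Lemma finite_ball u n : finite_set [set v | (d u v <= n)%N].
Proof.
elim: n => [|n IH].
  apply: (@sub_finite_set _ _ [set u]); last exact: finite_set1.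
  move=> v /=; rewrite leqn0 => /eqP uv.
  by have := gdist0_eq (adj_connected hT) uv.
apply: (@sub_finite_set _ _ ([set u] `|` \bigcup_(x in [set v | (d u v <= n)%N]) [set v | e x v])).
  move=> v /=; case uv : (d u v) => [|m].
    by left; have := gdist0_eq (adj_connected hT) uv.
  move=> mn; rewrite (tdistC hT) in uv.
  have [x vx xu] := tdist_step hT uv; right; exists x => /=.
    by rewrite (tdistC hT) xu.
  by rewrite (adjC hT).
rewrite finite_setU; split; first exact: finite_set1.
by apply: bigcup_finite => // x _; exact: finite_nbrs.
Qed.

Hypothesis hk : (2 < k)%N.

(** Among three distinct neighbours of [u], at most one is [par u] and at most one is [a]. *)
Lemma exists_child u a : exists2 v, par v = u & v != a.
Proof.
have [[_ _ _ _ /(_ u) /card_set_bijP[g [_ _ gsurj]]] _] := hT.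
have [i|f fP] := @choice _ _ (fun i v => (i < k)%N -> e u v /\ g v = i).
  have [ik|ki] := ltnP i k; last by exists u.
  by have [v uv gv] := gsurj i ik; exists v.
have fu i : (i < k)%N -> f i = par u \/ par (f i) = u.
  by move=> ik; have [] := (adj_par hT u (f i)).1 (fP i ik).1; [left|right].
apply: contrapT => noc.
have fa i : (i < k)%N -> f i = par u \/ f i = a.
  move=> ik; have [->|fiu] := fu _ ik; [by left|right].
  by apply/eqP/negPn/negP => fia; apply: noc; exists (f i).
have inj i j : (i < k)%N -> (j < k)%N -> f i = f j -> i = j.
  by move=> /fP[_ {2}<-] /fP[_ {2}<-] ->.
have k0 : (0 < k)%N by lia.
have k1 : (1 < k)%N by lia.
have [f0|f0] := fa _ k0; have [f1|f1] := fa _ k1; have [f2|f2] := fa _ hk.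
all: solve [by have := inj _ _ k0 k1 (etrans f0 (esym f1))
          | by have := inj _ _ k0 hk (etrans f0 (esym f2))
          | by have := inj _ _ k1 hk (etrans f1 (esym f2))].
Qed.

Lemma exists_descendant u n : exists v, iter n par v = u.
Proof.
elim: n => [|n [v <-]]; first by exists u.
by have [x <- _] := exists_child v v; exists x; rewrite iterSr.
Qed.

Lemma exists_descendant_avoiding u a n :
  exists2 v, iter n.+1 par v = u & iter n par v != a.
Proof.
have [c cu ca] := exists_child u a; have [v vc] := exists_descendant c n.
by exists v; rewrite /= vc.
Qed.

Lemma exists_height (i : int) : exists u, h u = i.
Proof.
(* This [v] has height [|i|], from which [|i| - i] parents lead to height [i]. *)
have [v vo] := exists_descendant (iter `|i| par o) (`|i| + `|i|).
have hv := height_iter_par hT (`|i| + `|i|)%N v.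
rewrite vo (height_iter_par hT) (height_origin hT) in hv.
by exists (iter (`|(`|i|%:Z - i)|)%N par v); rewrite (height_iter_par hT); lia.
Qed.

(** Leave the geodesic from [o] to the reference end at its [N]-th vertex, through a child not on
    that geodesic, and go [i + N] generations away from the end. *)
Lemma exists_escaping (i : int) (N : nat) : (0 < N)%N -> - N%:Z < i ->
  exists2 x, h x = i & h (meet o x) = - N%:Z.
Proof.
case: N => // N _ Ni.
have [n nE] : exists n : nat, i + N.+1%:Z = n.+1%:Z.
  by exists (`|(i + N.+1%:Z)%R|.-1)%N; lia.
have [x xN xa] := exists_descendant_avoiding (iter N.+1 par o) (iter N par o) n.
have hx : h x = i.
  have := height_iter_par hT n.+1 x.
  by rewrite xN (height_iter_par hT) (height_origin hT); lia.
exists x => //; have := iter_par_fork hT xN xa; have := tdist_height hT x o.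
rewrite (tmeetC hT) hx (height_origin hT); lia.
Qed.

End Meet.

(** * The distance of the Diestel-Leader graph *)

(** Taking four tree vertices instead of two vertices of the graph lets the roles of the trees be
    exchanged. *)
Definition horo_product_dist (T T' : marked_graph) (v : T) (v' : T') (w : T) (w' : T') : int :=
  - 2 * height (meet v w) - 2 * height (meet v' w') - `|height v - height w|.

Section HoroProduct.
Context {k k' : nat} {T T' : marked_graph}.
Hypothesis hT : is_marked_regular_tree k T.
Hypothesis hT' : is_marked_regular_tree k' T'.
Implicit Types u v w : T.
Local Notation F := (@horo_product_dist T T').

Lemma horo_product_distC v (v' : T') w (w' : T') : height v + height v' = 0 ->
  height w + height w' = 0 -> F v v' w w' = horo_product_dist v' v w' w.
Proof. by rewrite /horo_product_dist; lia. Qed.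

Lemma horo_product_dist_ge0 v (v' : T') w (w' : T') : height v + height v' = 0 ->
  height w + height w' = 0 -> 0 <= F v v' w w'.
Proof.
rewrite /horo_product_dist.
have := meet_le hT v w; have := meet_le_r hT v w.
by have := meet_le hT' v' w'; have := meet_le_r hT' v' w'; lia.
Qed.

(** Every edge of the Diestel-Leader graph joins some [(v, par u')] to [(par v, u')], so this is the
    edge condition of [gdist_potential]. *)
Lemma horo_product_dist_par v (u' : T') w (w' : T') : height v + height (par u') = 0 ->
  height w + height w' = 0 ->
  F v (par u') w w' <= F (par v) u' w w' + 1 /\
  F (par v) u' w w' <= F v (par u') w w' + 1.
Proof.
rewrite /horo_product_dist (height_par hT) (height_par hT').
have := meet_le hT v w; have := meet_le_r hT v w.
have := meet_le hT' u' w'; have := meet_le_r hT' u' w'.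
have [lt|eq] : height (meet v w) < height v \/ height (meet v w) = height v.
- by have := meet_le hT v w; lia.
- rewrite (meet_par_lt hT lt).
  have [lt'|eq'] : height (meet u' w') < height u' \/ height (meet u' w') = height u'.
  + by have := meet_le hT' u' w'; lia.
  + by rewrite (meet_par_lt hT' lt'); lia.
  + by rewrite (meet_par_eq hT' eq'); lia.
- rewrite (meet_par_eq hT eq).
  have [lt'|eq'] : height (meet u' w') < height u' \/ height (meet u' w') = height u'.
  + by have := meet_le hT' u' w'; lia.
  + by rewrite (meet_par_lt hT' lt'); lia.
  + by rewrite (meet_par_eq hT' eq'); lia.
Qed.

Hypothesis hk : (2 < k)%N.
Hypothesis hk' : (2 < k')%N.

(* A shortest path first descends to the meet in [T], then climbs until the
   meet in [T'] is reached, and finally descends to the target. *)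
Lemma horo_product_descent_le v (v' : T') w (w' : T') :
  height v + height v' = 0 -> height w + height w' = 0 ->
  (v, v') <> (w, w') -> height v <= height w ->
  exists u (u' : T'), [/\ adj T v u, adj T' v' u', height u + height u' = 0 &
    F v v' w w' = F u u' w w' + 1].
Proof.
move=> vv ww vw vwh; rewrite /horo_product_dist.
have mv := meet_le hT v w; have mw := meet_le_r hT v w.
have mv' := meet_le hT' v' w'; have mw' := meet_le_r hT' v' w'.
have [lt|eq] : height (meet v w) < height v \/ height (meet v w) = height v by lia.
  have [c cv _] := exists_child hT' hk' v' v'.
  exists (par v), c.
  have hc := height_par hT' c; rewrite cv in hc.
  split; [exact: par_adj hT _|by rewrite -cv (adj_par_r hT')|by rewrite (height_par hT); lia|].
  rewrite (meet_par_lt hT lt) (height_par hT).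
  have mc := meet_le_r hT' c w'.
  (* Since [height w' <= height v' < height c], the child [c] has the same meet with [w'] as
     [v']. *)
  have ltc : height (meet c w') < height c by lia.
  by have := meet_par_lt hT' ltc; rewrite cv; lia.
have [vm vE vmE] := meet_eq_height hT eq.
(* Otherwise [v] and [v'] are ancestors of [w] and [w']; as opposite heights sum to zero, both pairs
   coincide. *)
have lt' : height (meet v' w') < height v'.
  have [//|eq'] : height (meet v' w') < height v' \/ height (meet v' w') = height v'.
    by lia.
  have [[|m'] v'E v'mE] := meet_eq_height hT' eq'; last by lia.
  have vm0 : vm = 0%N by lia.
  by case: vw; rewrite vE v'E vm0.
(* The child [c] leads towards [w] when [v] is a strict ancestor of [w], and is arbitrary when
   [v = w]. *)
have [c [cv cw]] : exists c, par c = v /\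
    (height v < height w /\ height (meet c w) = height v + 1 \/
     height v = height w /\ height (meet c w) = height v).
  case: vm vE vmE => [|m] vE vmE.
    have [c cv _] := exists_child hT hk v v; exists c; split=> //; right.
    have hc := height_par hT c; rewrite cv in hc.
    have mc := meet_le_r hT c w.
    have ltc : height (meet c w) < height c by lia.
    by have := meet_par_lt hT ltc; rewrite cv; lia.
  exists (iter m par w); split=> //; left.
  have := height_iter_par hT m w; have := meet_le hT (iter m par w) w.
  by have := @meet_ge _ _ hT (iter m par w) w 0%N m erefl; lia.
exists c, (par v').
have hc := height_par hT c; rewrite cv in hc.
split; [by rewrite -cv (adj_par_r hT)|exact: par_adj hT' _|by rewrite (height_par hT'); lia|].
by rewrite (meet_par_lt hT' lt'); lia.
Qed.

End HoroProduct.

Lemma horo_product_descent (k k' : nat) (T T' : marked_graph)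
    (hT : is_marked_regular_tree k T) (hT' : is_marked_regular_tree k' T')
    (v : T) (v' : T') (w : T) (w' : T') :
  (2 < k)%N -> (2 < k')%N ->
  height v + height v' = 0 -> height w + height w' = 0 -> (v, v') <> (w, w') ->
  exists u u', [/\ adj T v u, adj T' v' u', height u + height u' = 0 &
    horo_product_dist v v' w w' = horo_product_dist u u' w w' + 1].
Proof.
move=> hk hk' vv ww vw.
have [le|lt] := leP (height v) (height w).
  exact: (horo_product_descent_le hT hT' hk hk').
have vw' : (v', v) <> (w', w) by move=> [? ?]; apply: vw; congr pair.
rewrite addrC in vv; rewrite addrC in ww.
have [|u' [u [? ? uu eq]]] := horo_product_descent_le hT' hT hk' hk vv ww vw'.
  by lia.
exists u, u'; split=> //; first by rewrite addrC.
by rewrite !(@horo_product_distC T T') //; rewrite addrC.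
Qed.

(* [val] on [DL T T'] elaborates to several convertible terms that [lia] does
   not identify; these projections give the coordinates a single form. *)
Definition DL_fst (T T' : marked_graph) (v : DL T T') : T := (val v).1.

Definition DL_snd (T T' : marked_graph) (v : DL T T') : T' := (val v).2.

Lemma DL_eq (T T' : marked_graph) (v w : DL T T') :
  DL_fst v = DL_fst w -> DL_snd v = DL_snd w -> v = w.
Proof.
rewrite /DL_fst /DL_snd => v1 v2; apply: val_inj.
by rewrite [LHS]surjective_pairing [RHS]surjective_pairing v1 v2.
Qed.

Section DiestelLeader.
Context {p q : nat} {T T' : marked_graph}.
Hypothesis hT : is_marked_regular_tree p T.
Hypothesis hT' : is_marked_regular_tree q T'.
Hypothesis hp : (2 < p)%N.
Hypothesis hq : (2 < q)%N.
Implicit Types v w : DL T T'.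
Local Notation h := (@height T).
Local Notation h' := (@height T').

Lemma DL_height v : h (DL_fst v) + h' (DL_snd v) = 0.
Proof. exact/eqP/(valP v). Qed.

Definition DL_vertex (v : T) (v' : T') (vv : h v + h' v' = 0) : DL T T' :=
  exist _ (v, v') (introT eqP vv).

Lemma DL_potential_self w :
  `|horo_product_dist (DL_fst w) (DL_snd w) (DL_fst w) (DL_snd w)|%N = 0%N.
Proof.
by rewrite /horo_product_dist (meet_xx hT) (meet_xx hT'); have := DL_height w; lia.
Qed.

Lemma DL_descent v w : v != w -> exists2 u, DL_adj T T' v u &
  `|horo_product_dist (DL_fst v) (DL_snd v) (DL_fst w) (DL_snd w)|%N =
  `|horo_product_dist (DL_fst u) (DL_snd u) (DL_fst w) (DL_snd w)|%N.+1.
Proof.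
move=> vw.
have [|u [u' [vu vu' uu eq]]] := @horo_product_descent _ _ _ _ hT hT'
    (DL_fst v) (DL_snd v) _ _ hp hq (DL_height v) (DL_height w).
  by move=> [? ?]; move/eqP: vw; apply; exact: DL_eq.
exists (DL_vertex uu); first exact/andP.
have := horo_product_dist_ge0 hT hT' (DL_height (DL_vertex uu)) (DL_height w).
by rewrite -[DL_fst (DL_vertex uu)]/u -[DL_snd (DL_vertex uu)]/u'; lia.
Qed.

Lemma DL_connected v w : exists2 s, path (DL_adj T T') v s & last v s = w.
Proof.
have [s [vs sw _]] := potential_walk
  (F := fun v => `|horo_product_dist (DL_fst v) (DL_snd v) (DL_fst w) (DL_snd w)|%N)
  (DL_potential_self w) (fun u => @DL_descent u w) v.
by exists s.
Qed.

Lemma DL_adj_sym : symmetric (DL_adj T T').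
Proof. by move=> v w; rewrite /DL_adj (adjC hT) (adjC hT'). Qed.

Lemma DL_gdist v w : (gdist (DL_adj T T') v w)%:Z =
  horo_product_dist (DL_fst v) (DL_snd v) (DL_fst w) (DL_snd w).
Proof.
rewrite (gdist_potential
  (F := fun v => `|horo_product_dist (DL_fst v) (DL_snd v) (DL_fst w) (DL_snd w)|%N)
  (DL_potential_self w) _ (fun u => @DL_descent u w)).
  by rewrite gez0_abs//; apply: (horo_product_dist_ge0 hT hT'); exact: DL_height.
move=> x y /andP[xy xy'].
have {xy}/(adj_par hT) xy : adj T (DL_fst x) (DL_fst y) := xy.
have {xy'}/(adj_par hT') xy' : adj T' (DL_snd x) (DL_snd y) := xy'.
have hx := DL_height x; have hy := DL_height y; have hw := DL_height w.
have := horo_product_dist_ge0 hT hT' hx hw; have := horo_product_dist_ge0 hT hT' hy hw.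
suff : horo_product_dist (DL_fst x) (DL_snd x) (DL_fst w) (DL_snd w) <=
       horo_product_dist (DL_fst y) (DL_snd y) (DL_fst w) (DL_snd w) + 1 by lia.
(* In the first and last cases both coordinates move the same way, which would change the sum of the
   heights by two. *)
case: xy xy' => [yE|xE] [yE'|xE'].
- by move: hy; rewrite yE yE' (height_par hT) (height_par hT'); lia.
- rewrite xE' in hx *; rewrite yE.
  by have [] := horo_product_dist_par hT hT' hx hw.
- rewrite yE' in hy *; rewrite xE.
  by have [] := horo_product_dist_par hT hT' hy hw.
- by move: hx; rewrite xE xE' (height_par hT) (height_par hT'); lia.
Qed.

End DiestelLeader.

(** * The horoboundary of an integer-valued metric *)

(** Differences are insensitive to additive constants, and for integer-valued distances their
    convergence is eventual equality. *)
Definition limit_function (R : realType) (E : Type) (d : E -> E -> R) (f : E -> R) : Prop :=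
  exists2 F : set_system E, ProperFilter F &
    forall y z, \forall x \near F, f y - f z = d y x - d z x.

Lemma ptws_near_dist (R : realType) (E : choiceType) (f : {ptws E -> R}) (x : E) (eps : R) :
  0 < eps -> nbhs f [set g : {ptws E -> R} | `|f x - g x| < eps].
Proof.
move=> e0; have fx : nbhs (f x) [set r : R | `|f x - r| < eps] by exact: nbhsx_ballx.
exact: (@proj_continuous E (fun=> R) x f _ fx).
Qed.

(** The topology is the supremum of the pullbacks along evaluations, so convergence is tested at
    each [y]. *)
Lemma ptws_cvg (R : realType) (E X : choiceType) (F : set_system X) (g : X -> {ptws E -> R})
    (f : {ptws E -> R}) : Filter F ->
  (forall y, \forall x \near F, g x y = f y) -> g @ F --> f.
Proof.
move=> FF gf; apply/cvg_sup => y.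
apply/cvg_image; first by rewrite eqEsubset; split=> v // _; exists (cst v).
move=> W /nbhs_singleton Wf; exists (@^~ y @^-1` W).
  by apply: filterS (gf y) => x /= ->.
by rewrite eqEsubset; split => [j [? + <-//]|j Wj]; exists (fun=> j).
Qed.

Section HoroboundaryOfIntegralMetric.
Context {R : realType} {E : choiceType} (d : E -> E -> R).
Hypothesis dC : forall x y, d x y = d y x.
Hypothesis d_triangle : forall x y z, d x z <= d x y + d y z.
Hypothesis d_nat : forall x y, exists n : nat, d x y = n%:R.

Lemma dist_lipschitz x c : lipschitz1 d (fun y => d y x + c).
Proof.
move=> y z; rewrite opprD addrACA subrr addr0 ler_norml.
have := d_triangle y z x; have := d_triangle z y x; rewrite [d z y]dC; lra.
Qed.

Lemma dist_lipschitz0 x : lipschitz1 d (fun y => d y x).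
Proof. by move=> y z; have := dist_lipschitz x 0 y z; rewrite !addr0. Qed.

Definition lipschitz1_sub f (fl : lipschitz1 d f) : set_type (lipschitz1 d) :=
  exist (fun g => g \in lipschitz1 d) f (mem_set fl).

(** All representatives of the classes of distance functions, so that the closure can be computed
    before passing to the quotient. *)
Definition translated_distances : set {ptws E -> R} :=
  [set f | exists x c, f = fun y => d y x + c].

Lemma limit_function_lipschitz f : limit_function d f -> lipschitz1 d f.
Proof.
move=> [F FF Ff] y z; have [x ->] := filter_ex (Ff y z).
by have := dist_lipschitz x 0 y z; rewrite !addr0.
Qed.

Lemma closure_translated_distances :
  closure translated_distances = [set f | limit_function d f].
Proof.
apply/seteqP; split=> f.
  move=> fD.
  (* Each neighbourhood of [f] yields the set of vertices whose distance function has a translate in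
     it; these sets generate [F]. *)
  pose F : set_system E := [set A | exists2 V : set {ptws E -> R}, nbhs f V &
    forall x c, V (fun y => d y x + c) -> A x].
  have FF : ProperFilter F.
    split; first by move=> [V fV] h; have [_ [[x [c ->]] /h]] := fD _ fV.
    split.
    - by exists setT => //; exact: filterT.
    - move=> A B [V fV VA] [W fW WB]; exists (V `&` W); first exact: filterI.
      by move=> x c [/VA ? /WB ?].
    - by move=> A B AB [V fV VA]; exists V => // x c /VA /AB.
  exists F => // y z.
  have near_yz (eps : R) : 0 < eps ->
      nbhs (f : {ptws E -> R}) [set g | `|(f y - f z) - (g y - g z)| < eps].
    move=> e0.
    have e2 : 0 < eps / 2 by rewrite divr_gt0.
    apply: filterS (filterI (ptws_near_dist f y e2) (ptws_near_dist f z e2)) => g /= [gy gz].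
    have tri (a b u v : R) : `|(a - b) - (u - v)| <= `|a - u| + `|b - v|.
      by rewrite (_ : _ - _ = (a - u) - (b - v)) ?ler_normB//; lra.
    by rewrite (le_lt_trans (tri _ _ _ _))// [ltRHS]splitr ltrD.
  have int_yz x : exists m : int, d y x - d z x = m%:~R.
    have [a ->] := d_nat y x; have [b ->] := d_nat z x.
    by exists (a%:Z - b%:Z); rewrite intrB.
  have transl (a b c : R) : (a + c) - (b + c) = a - b by lra.
  have [_ [[x [c ->]] /= xyz]] := fD _ (near_yz (1/2) ltac:(lra)).
  have [m mE] := int_yz x.
  (* If not, a translate whose difference is strictly closer than [m] gives an integer [m'] distinct
     from [m] with [|m - m'| < 1]. *)
  have yzm : f y - f z = m%:~R.
    apply/eqP; rewrite -subr_eq0; apply/negP => /negP ne.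
    have e0 : 0 < Num.min (1/2) `|f y - f z - m%:~R|.
      by rewrite lt_min normr_gt0 ne andbT; lra.
    have [_ [[x' [c' ->]] /= xyz']] := fD _ (near_yz _ e0).
    have [m' mE'] := int_yz x'.
    rewrite transl mE in xyz; rewrite transl mE' in xyz'.
    move: xyz'; rewrite lt_min => /andP[x1 x2].
    suff mm' : m = m' by rewrite mm' ltxx in x2.
    have : `|(m - m')%:~R : R| < 1.
      rewrite (_ : (m - m')%:~R = (f y - f z - m'%:~R) - (f y - f z - m%:~R)).
        by rewrite (le_lt_trans (ler_normB _ _))//; lra.
      by rewrite intrB; lra.
    by rewrite -intr_norm (_ : 1 = 1%:~R)// ltr_int; lia.
  exists [set g | `|(f y - f z) - (g y - g z)| < 1]; first exact: near_yz.
  move=> x' c' /=.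
  have [m' mE'] := int_yz x'.
  rewrite transl mE' yzm -intrB -intr_norm (_ : 1 = 1%:~R)// ltr_int => mm'.
  by congr (_%:~R); lia.
move=> [F FF Ff] V fV.
have [x0 _] := filter_ex (@filterT _ F _).
(* Normalised to agree with [f] at [x0], the translates eventually agree with [f] at each point. *)
pose g x : {ptws E -> R} := fun y => d y x + (f x0 - d x0 x).
have gf : g @ F --> (f : {ptws E -> R}).
  by apply: ptws_cvg => y; apply: filterS (Ff y x0) => x /=; rewrite /g; lra.
have /filter_ex[x gV] : F (g @^-1` V) := gf _ fV.
by exists (g x); split=> //; exists x, (f x0 - d x0 x).
Qed.

Lemma cst_class_eq (f g : set_type (lipschitz1 d)) c :
  (forall y, val f y = val g y + c) -> cst_class f = cst_class g.
Proof. by move=> fg; apply/eqquotP/asboolP; exists c. Qed.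

Lemma cst_class_inj (f g : set_type (lipschitz1 d)) :
  cst_class f = cst_class g -> exists c, forall y, val f y = val g y + c.
Proof. by move=> /eqquotP/asboolP. Qed.

Lemma limit_function_translate f c :
  limit_function d f -> limit_function d (fun y => f y + c).
Proof.
move=> [F FF Ff]; exists F => // y z; apply: filterS (Ff y z) => x /=; lra.
Qed.

Lemma closure_distance_functions :
  closure (cst_classes d (distance_functions d)) = cst_classes d (limit_function d).
Proof.
apply/seteqP; split.
  (* Limit functions are stable under adding constants, so the preimage of this set is the trace of
     a closed set of functions. *)
  have : closed (cst_classes d (limit_function d)).
    rewrite -openC /open/= /quotient_open.
    suff -> : \pi_(lipschitz1_mod_cst d) @^-1` (~` cst_classes d (limit_function d)) =
        set_val @^-1` (~` closure translated_distances).
      apply: open_comp; last exact/closed_openC/closed_closure.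
      by move=> f _; exact: initial_continuous.
    apply/seteqP; split=> f /= nf; rewrite closure_translated_distances in nf *.
      by move=> fl; apply: nf; exists f.
    move=> [g gl /cst_class_inj[c gf]]; apply: nf => /=.
    rewrite (_ : set_val f = (fun y => val g y + (- c))).
      exact: limit_function_translate.
    by apply/funext => y; rewrite gf addrK.
  move=> /closure_id ->; apply: closureS => _ [f [x fx] <-]; exists f => //=.
  rewrite fx; exists (principal_filter x); first exact: principal_filter_proper.
  by move=> y z; apply/principal_filterP.
move=> _ [f fl <-] U Uf.
(* The preimage of [U] contains the trace of a pointwise open [W] around [f], and a translated
   distance in [W] has its class in [U]. *)
have : nbhs (f : set_type (lipschitz1 d)) (@cst_class _ _ d @^-1` U) by exact: pi_continuous Uf.
case=> _ [[W oW <-] /= Wf] WU.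
have fD : closure translated_distances (set_val f) by rewrite closure_translated_distances.
have [g [[x [c gE]] gW]] := fD W (open_nbhs_nbhs (conj oW Wf)).
have gl : lipschitz1 d g by rewrite gE; exact: dist_lipschitz.
pose dx := lipschitz1_sub (dist_lipschitz0 x).
exists (cst_class dx); split; first by exists dx => //; exists x.
rewrite -(@cst_class_eq (lipschitz1_sub gl) dx c); first exact: (WU (lipschitz1_sub gl)).
by move=> y /=; rewrite gE.
Qed.

(** Beyond this criterion the quotient topology disappears and only [limit_function] matters. *)
Lemma horoboundary_eq (H : set (E -> R)) :
  H `<=` limit_function d ->
  (forall f, limit_function d f -> (exists x, exists c, forall y, f y = d y x + c) \/
     exists2 g, H g & exists c, forall y, f y = g y + c) ->
  (forall f x c, H f -> ~ forall y, f y = d y x + c) ->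
  horoboundary d = cst_classes d H.
Proof.
move=> Hl lH Hd; rewrite /horoboundary closure_distance_functions.
apply/seteqP; split=> [_ [[f fl <-] nf]|_ [f Hf <-]].
  have [[x [c fx]]|[g Hg [c fg]]] := lH _ fl.
    case: nf; exists (lipschitz1_sub (dist_lipschitz0 x)); first by exists x.
    exact/esym/(cst_class_eq (c := c)).
  have gl : lipschitz1 d g := limit_function_lipschitz (Hl _ Hg).
  by exists (lipschitz1_sub gl) => //; exact/esym/(cst_class_eq (c := c)).
split; first by exists f => //; exact: Hl.
move=> [g [x gx] /cst_class_inj[c gf]]; apply: (Hd _ x (- c) Hf) => y.
by have := gf y; rewrite gx => ->; rewrite addrK.
Qed.

End HoroboundaryOfIntegralMetric.

(** * Limits of distance functions *)

Section EndDistance.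
Context {k : nat} {T : marked_graph}.
Hypothesis hT : is_marked_regular_tree k T.
Local Notation e := (adj T).
Local Notation d := (@tdist T).
Local Notation o := (origin T).
Local Notation h := (@height T).
Implicit Types u v x y z : T.

(** Makes [to_end] stable under intersection. Beyond a far vertex of [r], distances from [s 0] and
    [s m] are Busemann values plus a common term, and these values differ by [m]. *)
Lemma beyond_sub w r s m : ends e w -> w r -> w s ->
  exists N, forall n x, (N <= n)%N -> (d (r 0%N) (r n) + d (r n) x = d (r 0%N) x)%N ->
    (d (s 0%N) (s m) + d (s m) x = d (s 0%N) x)%N.
Proof.
move=> we wr ws; have rray := end_geodesic we wr; have sray := end_geodesic we ws.
have [c rs] := busemann_cofinal hT rray sray (end_cofinal we wr ws).
have [N0 _ s0] := busemann_beyond hT rray (s 0%N).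
have [N1 _ s1] := busemann_beyond hT rray (s m).
exists (maxn N0 N1) => n x; rewrite geq_max => /andP[n0 n1] rx.
have := s0 _ _ n0 rx; have := s1 _ _ n1 rx; have := busemann_ray hT sray 0.
by have := busemann_ray hT sray m; rewrite !rs (ray_dist sray)//; lia.
Qed.

Lemma to_end_proper w : ends e w -> ProperFilter (to_end e w).
Proof.
move=> we; split.
  move=> [r wr [n /(_ (r n))]] /=; apply; apply/(on_geodesic_tdist hT).
  by rewrite [d (r n) _]tdistxx addn0.
split.
- by have [r wr] := end_ray we; exists r => //; exists 0%N.
- move=> A A' [r wr [n rA]] [s ws [m sA]].
  have [N rN] := beyond_sub n we wr wr; have [M sM] := beyond_sub m we wr ws.
  exists r => //; exists (maxn N M) => x /= /(on_geodesic_tdist hT) xr.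
  by split; [apply: rA|apply: sA]; apply/(on_geodesic_tdist hT);
    [apply: rN xr|apply: sM xr]; rewrite ?leq_maxl ?leq_maxr.
- by move=> A A' AA [r wr [n rA]]; exists r => //; exists n => x /rA /AA.
Qed.

Lemma end_distE (R : realType) w r y : ends e w -> w r ->
  end_dist R w y = (busemann e r y - busemann e r o)%:~R.
Proof.
move=> we wr; have wF := to_end_proper we.
have rray := end_geodesic we wr.
apply: cvg_lim => //; apply: cvg_near_cst.
have [N0 _ yB] := busemann_beyond hT rray y.
have [N1 _ oB] := busemann_beyond hT rray o.
exists r => //; exists (maxn N0 N1) => x /= /(on_geodesic_tdist hT) rx.
have := yB _ _ (leq_maxl N0 N1) rx; have := oB _ _ (leq_maxr N0 N1) rx => ox yx.
rewrite -[X in X - _]mulrz_nat -[X in _ - X]mulrz_nat -intrB; congr (_%:~R); lia.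
Qed.

Lemma meet_escaping x y : h (meet o x) < h (meet o y) -> h (meet y x) = h (meet o x).
Proof.
rewrite (tmeetC hT y x) (tmeetC hT o x); exact: (meet_ultra_eq hT).
Qed.

(** From [r n], go away from the reference end through a child other than the previous vertex of the
    ray, for enough generations to offset the height of [r n]. *)
Lemma exists_high_beyond (r : nat -> T) n : (2 < k)%N -> geodesic_ray e r -> (0 < n)%N ->
  exists2 x, (d (r 0%N) (r n) + d (r n) x = d (r 0%N) x)%N & n%:Z <= h x.
Proof.
case: n => // n hk rray _.
pose m := (n.+1 + `|h (r n.+1)|)%N.
have [x xr xa] := exists_descendant_avoiding hT hk (r n.+1) (r n) m.
have bx : d (r n.+1) x = m.+1 by rewrite -xr (tdistC hT) (tdist_iter_par hT).
exists x; last by have := height_iter_par hT m.+1 x; rewrite xr /m; lia.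
have rn : d (r 0%N) (r n.+1) = (d (r 0%N) (r n)).+1 by rewrite !(ray_dist rray)// !subn0.
have [ab|ba] := tdist_adjVS hT x (ray_adj hT rray n).
  exact/esym/(tdist_split hT (ray_adj hT rray n) rn ab).
case/eqP: xa; apply: (tdist_closer_unique hT (u := r n.+1) (z := x)).
- by rewrite -xr; exact: (adj_par_r hT).
- by rewrite (adjC hT); exact: (ray_adj hT).
- by rewrite bx (tdistC hT) (tdist_iter_par hT).
- by rewrite ba.
Qed.

End EndDistance.

(** * Limits along ultrafilters in one tree *)

Section Ultrafilters.
Context {X : Type} {U : set_system X}.
Hypothesis UU : UltraFilter U.

Lemma ultra_finite (Y : choiceType) (A : set Y) (g : X -> Y) : finite_set A ->
  (\forall x \near U, A (g x)) -> exists a, \forall x \near U, g x = a.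
Proof.
move=> /finite_seqP[s ->]; elim: s => [|a s IH] gs.
  by have [x] := filter_ex gs.
have [ga|ga] := in_ultra_setVsetC [set x | g x = a] UU; first by exists a.
apply: IH; apply: filterS2 gs ga => x /=.
by rewrite inE => /orP[/eqP|].
Qed.

Context {k : nat} {T : marked_graph}.
Hypothesis hT : is_marked_regular_tree k T.
Local Notation e := (adj T).
Local Notation d := (@tdist T).
Local Notation o := (origin T).
Local Notation h := (@height T).
Variable g : X -> T.

(** Once [g x] meets [o] below the meet of [o] and [y], it meets [y] at that same height. *)
Lemma ultra_escaping : (forall N : nat, \forall x \near U, h (meet o (g x)) < - N%:Z) ->
  forall y z, \forall x \near U, h (meet y (g x)) = h (meet z (g x)).
Proof.
move=> gN.
suff gy y : \forall x \near U, h (meet y (g x)) = h (meet o (g x)).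
  by move=> y z; apply: filterS2 (gy y) (gy z) => x -> ->.
apply: filterS (gN `|h (meet o y)|%N) => x xN.
by apply: (meet_escaping hT); lia.
Qed.

(** With constant height, a lower bound on the meet with [o] confines [g x] to a finite ball;
    without one the meet escapes. *)
Lemma ultra_constant_or_escaping i : (\forall x \near U, h (g x) = i) ->
  (exists x0, \forall x \near U, g x = x0) \/
  forall y z, \forall x \near U, h (meet y (g x)) = h (meet z (g x)).
Proof.
move=> gi; have [[N gN]|noN] := pselect (exists N : nat,
    \forall x \near U, - N%:Z <= h (meet o (g x))); [left|right].
  apply: (ultra_finite (finite_ball hT o (`|i| + (N + N))%N)).
  apply: filterS2 gi gN => x hx mx /=.
  by have := tdist_height hT o (g x); rewrite (height_origin hT); lia.
apply: ultra_escaping => N.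
have [gN|] := in_ultra_setVsetC [set x | - N%:Z <= h (meet o (g x))] UU.
  by case: noN; exists N.
by apply: filterS => x /= /negP; rewrite -ltNge.
Qed.

(** The default [v] is taken at [v = x], where the walk stops. *)
Definition step_toward (x v : T) : T := xget v [set u | e v u /\ (d u x < d v x)%N].

Lemma step_toward_le x v n : (d v (iter n (step_toward x) v) <= n)%N.
Proof.
elim: n => [|n IH]; first by rewrite tdistxx.
have := tdist_triangle hT (iter n (step_toward x) v) v (iter n.+1 (step_toward x) v).
suff : (d (iter n (step_toward x) v) (iter n.+1 (step_toward x) v) <= 1)%N by lia.
rewrite iterS /step_toward; case: xgetP => [u _ [vu _]|_]; last by rewrite tdistxx.
by rewrite (tdist_adj hT).
Qed.

Lemma step_toward_dist x v n : (n <= d v x)%N ->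
  (d (iter n (step_toward x) v) x + n = d v x)%N.
Proof.
elim: n => [|n IH] nx; first by rewrite addn0.
have nE := IH (ltnW nx); set v' := iter n (step_toward x) v in nE *.
have [v'u v'ux] : [set u | e v' u /\ (d u x < d v' x)%N] (step_toward x v').
  apply: xgetPex; have [u v'u ux] := @tdist_step _ _ hT v' x (d v' x).-1 ltac:(lia).
  by exists u; split=> //; lia.
by rewrite iterS -/v' -nE; have := tdist_adjVS hT x v'u; lia.
Qed.

(** A compactness argument: the [n]-th vertex of the geodesic from [o] to [g x] lies in a finite
    ball, so the ultrafilter fixes it, and the fixed vertices form a ray. *)
Lemma ultra_end : (forall N : nat, \forall x \near U, N%:Z <= h (g x)) ->
  exists2 w, ends e w & forall (R : realType) y z, \forall x \near U,
    end_dist R w y - end_dist R w z = (d y (g x))%:R - (d z (g x))%:R.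
Proof.
move=> gN.
pose p n x := iter n (step_toward (g x)) o.
have far n : \forall x \near U, (n <= d o (g x))%N.
  apply: filterS (gN n) => x xn.
  have := tdist_height hT o (g x); have := meet_le hT o (g x).
  by rewrite (height_origin hT); lia.
have [n|r rP] := @choice _ _ (fun n v => \forall x \near U, p n x = v).
  apply: (ultra_finite (finite_ball hT o n)); apply: filterE => x.
  exact: step_toward_le.
have r0 : r 0%N = o by have [x <-] := filter_ex (rP 0%N).
have rdist n : \forall x \near U, (d (r n) (g x) + n = d o (g x))%N.
  by apply: filterS2 (rP n) (far n) => x <-; exact: step_toward_dist.
have rray : geodesic_ray e r.
  move=> m n mn; rewrite -/(tdist (r m) (r n)).
  have [x [[pm pn] [dm dn]]] := filter_ex (filterI (filterI (rP m) (rP n))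
    (filterI (rdist m) (rdist n))).
  have := step_toward_le (g x) (r m) (n - m).
  rewrite -{2}pm -iterD subnK// -/(p n x) pn.
  by have := tdist_triangle hT (r n) (r m) (g x); lia.
pose w : set (nat -> T) := [set s | geodesic_ray e s /\ cofinal_rays r s].
have we : ends e w by exists r.
exists w => //.
have wr : w r by split=> //; exists 0%N, 0%N.
move=> R y z; rewrite !(end_distE hT R _ we wr).
have [N0 _ yB] := busemann_beyond hT rray y.
have [N1 _ zB] := busemann_beyond hT rray z.
(* Eventually [g x] lies beyond [r n], where [busemann_beyond] computes its distances to [y] and
   [z]. *)
have behind n : \forall x \near U,
    (d (r 0%N) (r n) + d (r n) (g x) = d (r 0%N) (g x))%N.
  by apply: filterS (rdist n) => x rx; rewrite (ray_dist rray)// r0 -rx subn0 addnC.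
apply: filterS2 (behind N0) (behind N1) => x /(yB _ _ (leqnn _)) yx /(zB _ _ (leqnn _)) zx.
rewrite -[X in _ = X - _]mulrz_nat -[X in _ = _ - X]mulrz_nat -!intrB; congr (_%:~R); lia.
Qed.

End Ultrafilters.

(** * Exchanging the two trees *)

Definition DL_swap (T T' : marked_graph) (v : DL T T') : DL T' T :=
  DL_vertex (etrans (addrC _ _) (DL_height v)).

Lemma rho_endE (R : realType) (T T' : marked_graph) w (y : DL T T') :
  rho_end R w y = end_dist R w (DL_fst y).
Proof. by []. Qed.

Lemma rho_vertexE (R : realType) (T T' : marked_graph) (x0 : T) (y : DL T T') :
  rho_vertex R x0 y =
  (- 2 * height (meet (DL_fst y) x0) - `|height (DL_fst y) - height x0|)%:~R.
Proof. by []. Qed.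

Lemma rho_vertexE' (R : realType) (T T' : marked_graph) (x0 : T') (y : DL T T') :
  rho_vertex' R x0 y =
  (- 2 * height (meet (DL_snd y) x0) - `|height (DL_snd y) - height x0|)%:~R.
Proof. by []. Qed.

Lemma rho_levelE (R : realType) (T T' : marked_graph) (i : int) (y : DL T T') :
  rho_level R i y = (- `|height (DL_fst y) - i|)%:~R.
Proof. by []. Qed.

Section Swap.
Context {k k' : nat} {T T' : marked_graph}.
Hypothesis hT : is_marked_regular_tree k T.
Hypothesis hT' : is_marked_regular_tree k' T'.
Hypothesis hk : (2 < k)%N.
Hypothesis hk' : (2 < k')%N.
Variable R : realType.

Lemma DL_swapK : cancel (@DL_swap T T') (@DL_swap T' T).
Proof. by move=> v; apply: val_inj; case: v => -[]. Qed.

Lemma DL_distE (v w : DL T T') : DL_dist R T T' v w =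
  (horo_product_dist (DL_fst v) (DL_snd v) (DL_fst w) (DL_snd w))%:~R.
Proof. by rewrite -(DL_gdist hT hT' hk hk' v w) -pmulrn. Qed.

End Swap.

Section SwapLimit.
Context {k k' : nat} {T T' : marked_graph}.
Hypothesis hT : is_marked_regular_tree k T.
Hypothesis hT' : is_marked_regular_tree k' T'.
Hypothesis hk : (2 < k)%N.
Hypothesis hk' : (2 < k')%N.
Variable R : realType.

Lemma DL_dist_swap (v w : DL T T') :
  DL_dist R T' T (DL_swap v) (DL_swap w) = DL_dist R T T' v w.
Proof.
rewrite (DL_distE hT hT' hk hk') (DL_distE hT' hT hk' hk); congr (_%:~R).
exact/esym/(horo_product_distC (DL_height v) (DL_height w)).
Qed.

(** Transfers the results on [rho_end] and [rho_vertex] to their primed versions. *)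
Lemma limit_function_swap (g : DL T' T -> R) :
  limit_function (DL_dist R T' T) g ->
  limit_function (DL_dist R T T') (g \o @DL_swap T T').
Proof.
move=> [F FF Fg]; exists (@DL_swap T' T @ F); first exact: fmap_proper_filter.
move=> y z; apply: filterS (Fg (DL_swap y) (DL_swap z)) => x /= ->.
by rewrite -{1 2}(DL_swapK x) !DL_dist_swap.
Qed.

End SwapLimit.

(** * Realising the horofunctions, and limits at infinite height *)

Section HorofunctionsAreLimits.
Context {k k' : nat} {T T' : marked_graph}.
Hypothesis hT : is_marked_regular_tree k T.
Hypothesis hT' : is_marked_regular_tree k' T'.
Hypothesis hk : (2 < k)%N.
Hypothesis hk' : (2 < k')%N.
Variable R : realType.
Local Notation D := (DL_dist R T T').

Lemma DL_formula (y : DL T T') (x : T) (x' : T') (xx : height x + height x' = 0) :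
  horo_product_dist (DL_fst y) (DL_snd y) (DL_fst (DL_vertex xx)) (DL_snd (DL_vertex xx)) =
  - 2 * height (meet (DL_fst y) x) - 2 * height (meet (DL_snd y) x') -
  `|height (DL_fst y) - height x|.
Proof. by []. Qed.

Lemma limit_function_seq (f : DL T T' -> R) (x : nat -> DL T T') (c : nat -> R) :
  (forall y, \forall n \near \oo, D y (x n) = f y + c n) -> limit_function D f.
Proof.
move=> fx; exists (x @ \oo); first exact: fmap_proper_filter.
move=> y z; apply: filterS2 (fx y) (fx z) => n /= -> ->.
by rewrite opprD addrACA subrr addr0.
Qed.

Lemma near_height_gt (T0 : marked_graph) (y : T0) (m : nat -> nat) :
  (forall n, (n <= m n)%N) ->
  \forall n \near \oo, - (m n)%:Z < height (meet (origin T0) y).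
Proof.
move=> mn; exists `|height (meet (origin T0) y)|.+1 => // n /= hn.
by have := mn n; lia.
Qed.

Lemma rho_end_limit w : ends (adj T) w -> limit_function D (@rho_end R T T' w).
Proof.
move=> we; have [r wr] := end_ray we; have rray := end_geodesic we wr.
have [n|x xP] := @choice _ _ (fun n x =>
    (tdist (r 0%N) (r n.+1) + tdist (r n.+1) x = tdist (r 0%N) x)%N /\ n.+1%:Z <= height x).
  by have [x rx hx] := exists_high_beyond hT hk rray (ltn0Sn n); exists x.
(* The second coordinate is an ancestor of [origin T'], hence equal to its meet with it. *)
have [n|x' xP'] := @choice _ _ (fun n (x' : T') => height x' = - height (x n) /\
    height (meet (origin T') x') = - height (x n)).
  have [_ hx] := xP n; exists (iter `|height (x n)|%N par (origin T')).
  have hx' := height_iter_par hT' `|height (x n)|%N (origin T').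
  rewrite (height_origin hT') in hx'.
  have := meet_le_r hT' (origin T') (iter `|height (x n)|%N par (origin T')).
  have := @meet_ge _ _ hT' (origin T') (iter `|height (x n)|%N par (origin T'))
    `|height (x n)|%N 0%N erefl.
  by rewrite (height_origin hT'); lia.
have xx n : height (x n) + height (x' n) = 0 by have [-> _] := xP' n; lia.
(* For large [n] the distance from [y] reduces to the tree distance in [T], which [busemann_beyond]
   evaluates. *)
apply: (@limit_function_seq _ (fun n => DL_vertex (xx n))
  (fun n => (busemann (adj T) r (origin T) + (tdist (r 0%N) (x n))%:Z)%:~R)) => y.
have [N N0 yB] := busemann_beyond hT rray (DL_fst y).
have hx n : (n <= `|height (x n)|)%N by have [_] := xP n; lia.
have hy : \forall n \near \oo, height (DL_fst y) <= height (x n).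
  exists `|height (DL_fst y)|%N => // n /= yn; have [_] := xP n; lia.
have hm := near_height_gt (DL_snd y) hx.
have nN : \forall n \near \oo, (N <= n.+1)%N by exists N => // n /= /leqW.
apply: filterS3 hy hm nN => n hy hm nN; have [rx hxn] := xP n.
rewrite (DL_distE hT hT' hk hk') rho_endE (end_distE hT R _ we wr) -intrD.
congr (_%:~R); rewrite DL_formula.
have [hx' mx'] := xP' n.
rewrite (@meet_escaping _ _ hT' (x' n) (DL_snd y)) mx'; last by lia.
by have := yB _ _ nN rx; have := tdist_height hT (DL_fst y) (x n); lia.
Qed.

(** The first coordinate stays at [x0] while the second escapes at height [- height x0]. The meet at
    height [- N n] contributes the constant [2 * N n]. *)
Lemma rho_vertex_limit x0 : limit_function D (@rho_vertex R T T' x0).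
Proof.
pose N n := (n + `|height x0|).+1.
have [n|x' xP'] := @choice _ _ (fun n x' => height x' = - height x0 /\
    height (meet (origin T') x') = - (N n)%:Z).
  have [|x' hx mx] := @exists_escaping _ _ hT' hk' (- height x0) (N n) (ltn0Sn _).
    by rewrite /N; lia.
  by exists x'.
have xx n : height x0 + height (x' n) = 0 by have [-> _] := xP' n; lia.
apply: (@limit_function_seq _ (fun n => DL_vertex (xx n)) (fun n => (2 * (N n)%:Z)%:~R)) => y.
have Nn n : (n <= N n)%N by rewrite /N; lia.
apply: filterS (near_height_gt (DL_snd y) Nn) => n hm.
rewrite (DL_distE hT hT' hk hk') rho_vertexE -intrD; congr (_%:~R).
have [hx' mx'] := xP' n; rewrite DL_formula.
by rewrite (@meet_escaping _ _ hT' (x' n) (DL_snd y)) mx'; lia.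
Qed.

(** Both coordinates escape at fixed height, each contributing [2 * N n]. *)
Lemma rho_level_limit i : limit_function D (@rho_level R T T' i).
Proof.
pose N n := (n + `|i|).+1.
have [n|x xP] := @choice _ _ (fun n x => height x = i /\
    height (meet (origin T) x) = - (N n)%:Z).
  have [|x hx mx] := @exists_escaping _ _ hT hk i (N n) (ltn0Sn _).
    by rewrite /N; lia.
  by exists x.
have [n|x' xP'] := @choice _ _ (fun n x' => height x' = - i /\
    height (meet (origin T') x') = - (N n)%:Z).
  have [|x' hx mx] := @exists_escaping _ _ hT' hk' (- i) (N n) (ltn0Sn _).
    by rewrite /N; lia.
  by exists x'.
have xx n : height (x n) + height (x' n) = 0.
  by have [-> _] := xP' n; have [-> _] := xP n; lia.
apply: (@limit_function_seq _ (fun n => DL_vertex (xx n)) (fun n => (4 * (N n)%:Z)%:~R)) => y.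
have Nn n : (n <= N n)%N by rewrite /N; lia.
apply: filterS2 (near_height_gt (DL_fst y) Nn) (near_height_gt (DL_snd y) Nn) => n hm hm'.
rewrite (DL_distE hT hT' hk hk') rho_levelE -intrD; congr (_%:~R).
have [hx' mx'] := xP' n; have [hx mx] := xP n; rewrite DL_formula.
rewrite (@meet_escaping _ _ hT' (x' n) (DL_snd y)) mx'; last by lia.
by rewrite (@meet_escaping _ _ hT (x n) (DL_fst y)) mx ?hx; lia.
Qed.

(** The low values occur along a ray of the end, at descendants of [x0], and at heights [i + n]. *)
Lemma horofunction_unbounded_below (f : DL T T' -> R) :
  [\/ exists2 w, ends (adj T) w & f = @rho_end R T T' w,
      exists x0 : T, f = @rho_vertex R T T' x0 |
      exists i : int, f = @rho_level R T T' i] ->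
  exists m : int, forall n : nat, exists y, f y = (m - n%:Z)%:~R.
Proof.
have lift v : exists y : DL T T', (DL_fst y) = v.
  have [v' v'E] := exists_height hT' hk' (- height v).
  have vv : height v + height v' = 0 by lia.
  by exists (DL_vertex vv).
case=> [[w we ->]|[x0 ->]|[i ->]].
- have [r wr] := end_ray we; have rray := end_geodesic we wr.
  exists (- busemann (adj T) r (origin T)) => n; have [y yE] := lift (r n); exists y.
  rewrite rho_endE (end_distE hT R _ we wr) yE (busemann_ray hT rray).
  by congr (_%:~R); lia.
- exists (- 2 * height x0) => n.
  have [v vx] := exists_descendant hT hk x0 n; have [y yE] := lift v; exists y.
  have hv := height_iter_par hT n v.
  have := meet_le_r hT v x0; have := @meet_ge _ _ hT v x0 n 0%N vx.
  rewrite vx in hv; rewrite rho_vertexE yE => mv mx; congr (_%:~R); lia.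
- exists 0 => n; have [v vi] := exists_height hT hk (i + n%:Z).
  by have [y yE] := lift v; exists y; rewrite rho_levelE yE vi; congr (_%:~R); lia.
Qed.

(** Heights in [T'] tend to minus infinity, so the meets there cancel in differences and the tree
    distance of [T] remains. The map [g] allows use with the trees exchanged. *)
Lemma ultra_high (X : Type) (U : set_system X) (g : X -> DL T T') (f : DL T T' -> R) :
  UltraFilter U ->
  (forall y z, \forall x \near U, f y - f z = D y (g x) - D z (g x)) ->
  (forall N : nat, \forall x \near U, N%:Z <= height (DL_fst (g x))) ->
  exists2 w, ends (adj T) w & forall y z, f y - f z = @rho_end R T T' w y - rho_end R w z.
Proof.
move=> UU Uf hi.
have [w we wU] := @ultra_end _ _ UU _ _ hT (fun x => DL_fst (g x)) hi.
have esc := @ultra_escaping _ _ UU _ _ hT' (fun x => DL_snd (g x)).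
exists w => // y z; rewrite !rho_endE.
have low (t : DL T T') (N : nat) : N.+1%:Z <= height (DL_fst t) ->
    height (meet (origin T') (DL_snd t)) < - N%:Z.
  by have := meet_le_r hT' (origin T') (DL_snd t); have := DL_height t; lia.
have {}esc : \forall x \near U, height (meet (DL_snd y) (DL_snd (g x))) =
    height (meet (DL_snd z) (DL_snd (g x))).
  by apply: esc => N; apply: filterS (hi N.+1) => t; exact: low.
have [x [[fx wx] [[hyx hzx] ex]]] := filter_ex
  (filterI (filterI (Uf y z) (wU R (DL_fst y) (DL_fst z)))
  (filterI (filterI (hi `|height (DL_fst y)|%N) (hi `|height (DL_fst z)|%N)) esc)).
rewrite fx wx !(DL_distE hT hT' hk hk') !(pmulrn 1) -!intrB; congr (_%:~R).
have := tdist_height hT (DL_fst y) (DL_fst (g x)).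
have := tdist_height hT (DL_fst z) (DL_fst (g x)).
rewrite /horo_product_dist ex => -> ->.
lia.
Qed.

End HorofunctionsAreLimits.

(** * Classification of the limits *)

Section Classification.
Context {k k' : nat} {T T' : marked_graph}.
Hypothesis hT : is_marked_regular_tree k T.
Hypothesis hT' : is_marked_regular_tree k' T'.
Hypothesis hk : (2 < k)%N.
Hypothesis hk' : (2 < k')%N.
Variable R : realType.
Local Notation D := (DL_dist R T T').
Local Notation H := (DL_horofunctions R T T').

Lemma horofunction_limit f : H f -> limit_function D f.
Proof.
case=> [[w we ->]|[w we ->]|[x0 ->]|[[x0 ->]|[i ->]]].
- exact: (rho_end_limit hT hT' hk hk').
- apply: (limit_function_swap hT hT' hk hk' (g := @rho_end R T' T w)).
  exact: (rho_end_limit hT' hT hk' hk).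
- exact: (rho_vertex_limit hT hT' hk hk').
- apply: (limit_function_swap hT hT' hk hk' (g := @rho_vertex R T' T x0)).
  exact: (rho_vertex_limit hT' hT hk' hk).
- exact: (rho_level_limit hT hT' hk hk').
Qed.

Lemma horofunction_not_distance f x c : H f -> ~ forall y, f y = D y x + c.
Proof.
move=> Hf fx.
have [m fm] : exists m : int, forall n : nat, exists y, f y = (m - n%:Z)%:~R.
  case: Hf => [[w we fE]|[w we fE]|[x0 fE]|[[x0 fE]|[i fE]]].
  - by apply: (horofunction_unbounded_below hT hT' hk hk'); apply: Or31; exists w.
  - have [m fm] := @horofunction_unbounded_below _ _ T' T hT' hT hk' hk R _
      (Or31 _ _ (ex_intro2 _ _ w we erefl)).
    by exists m => n; have [y <-] := fm n; exists (DL_swap y); rewrite fE.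
  - by apply: (horofunction_unbounded_below hT hT' hk hk'); apply: Or32; exists x0.
  - have [m fm] := @horofunction_unbounded_below _ _ T' T hT' hT hk' hk R _
      (Or32 _ _ (ex_intro _ x0 erefl)).
    by exists m => n; have [y <-] := fm n; exists (DL_swap y); rewrite fE.
  - by apply: (horofunction_unbounded_below hT hT' hk hk'); apply: Or33; exists i.
(* This index exceeds [m - c], so [f y < c], whereas a distance plus [c] is at least [c]. *)
have [y yE] := fm (Num.truncn (m%:~R - c)).+1.
have D0 : 0 <= D y x by rewrite /DL_dist ler0n.
have := truncnS_gt (m%:~R - c).
have := fx y; rewrite yE intrB -pmulrn; lra.
Qed.

Lemma limit_function_classification f : limit_function D f ->
  (exists x, exists c, forall y, f y = D y x + c) \/
  exists2 g, H g & exists c, forall y, f y = g y + c.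
Proof.
move=> [F FF Ff]; have [b _] := filter_ex (@filterT _ F _).
have [U [UU FU]] := ultraFilterLemma FF.
have Uf y z : \forall x \near U, f y - f z = D y x - D z x by apply: FU; exact: Ff.
have shift (g : DL T T' -> R) : (forall y z, f y - f z = g y - g z) ->
    exists c, forall y, f y = g y + c.
  by move=> fg; exists (f b - g b) => y; have := fg y b; lra.
have [hi|nhi] := pselect (forall N : nat, \forall x \near U, N%:Z <= height (DL_fst x)).
  have [w we fw] := ultra_high (g := id) hT hT' hk hk' UU Uf hi.
  by right; exists (rho_end R w); [apply: Or41; exists w|exact: shift].
have [hi'|nhi'] := pselect (forall N : nat, \forall x \near U, N%:Z <= height (DL_snd x)).
  right; have [w we fw] : exists2 w, ends (adj T') w &
      forall y z, f y - f z = rho_end' R w y - rho_end' R w z.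
    have [|w we fw] := @ultra_high _ _ T' T hT' hT hk' hk R _ U (@DL_swap T T')
      (f \o @DL_swap T' T) UU _ hi'.
      move=> y z; apply: filterS (Uf (DL_swap y) (DL_swap z)) => x /= ->.
      by rewrite -[in RHS](DL_swapK y) -[in RHS](DL_swapK z) !(DL_dist_swap hT hT' hk hk').
    by exists w => // y z; have := fw (DL_swap y) (DL_swap z); rewrite /= !DL_swapK.
  by exists (rho_end' R w); [apply: Or42; exists w|exact: shift].
(* An ultrafilter decides every set, so not tending to infinity means being eventually bounded
   above. *)
have bnd (g : DL T T' -> int) : ~ (forall N : nat, \forall x \near U, N%:Z <= g x) ->
    exists N : nat, \forall x \near U, g x < N%:Z.
  move=> /existsNP[N gN]; exists N.
  have [//|] := in_ultra_setVsetC [set x | N%:Z <= g x] UU.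
  by apply: filterS => x /= /negP; rewrite -ltNge.
have [N hN] := bnd _ nhi; have [M hM] := bnd _ nhi'.
(* The height eventually lies strictly between [- M] and [N], so the ultrafilter fixes it. *)
have [i hi] : exists i : int, \forall x \near U, height (DL_fst x) = i.
  pose A := [set n%:Z - M%:Z | n in `I_(N + M)].
  apply: (@ultra_finite _ _ UU _ A); first exact/finite_image/finite_II.
  apply: filterS2 hN hM => x xN xM; exists `|(height (DL_fst x) + M%:Z)%R|%N => /=.
    by have := DL_height x; lia.
  by have := DL_height x; lia.
have hi' : \forall x \near U, height (DL_snd x) = - i.
  by apply: filterS hi => x; have := DL_height x; lia.
(* An escaping coordinate cancels in differences. The four cases yield a distance function,
   [rho_vertex], [rho_vertex'] and [rho_level]. *)
have [[x0 hx0]|esc] := @ultra_constant_or_escaping _ _ UU _ _ hT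
    (fun x : DL T T' => (DL_fst x)) i hi;
  have [[x0' hx0']|esc'] := @ultra_constant_or_escaping _ _ UU _ _ hT'
    (fun x : DL T T' => (DL_snd x)) (- i) hi'.
- left; have [x [xx0 xx0']] := filter_ex (filterI hx0 hx0'); exists x; apply: shift => y z.
  have [t [ft [t1 t2]]] := filter_ex (filterI (Uf y z) (filterI hx0 hx0')).
  by rewrite ft (_ : t = x)//; apply: DL_eq; rewrite ?t1 ?t2 ?xx0 ?xx0'.
- right; exists (rho_vertex R x0); first by apply: Or43; exists x0.
  apply: shift => y z.
  have [t [ft [t1 t2]]] := filter_ex (filterI (Uf y z) (filterI hx0 (esc' (DL_snd y) (DL_snd z)))).
  rewrite ft !(DL_distE hT hT' hk hk') !rho_vertexE -!intrB /horo_product_dist t1.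
  by congr (_%:~R); rewrite t2; lia.
- right; exists (rho_vertex' R x0'); first by apply: Or44; left; exists x0'.
  apply: shift => y z.
  have [t [ft [t1 t2]]] := filter_ex (filterI (Uf y z) (filterI hx0' (esc (DL_fst y) (DL_fst z)))).
  rewrite ft !(DL_distE hT hT' hk hk') !rho_vertexE' -!intrB /horo_product_dist t1.
  have := DL_height y; have := DL_height z; have := DL_height t.
  by rewrite t1 => *; congr (_%:~R); rewrite t2; lia.
- right; exists (rho_level R i); first by apply: Or44; right; exists i.
  apply: shift => y z.
  have [t [[ft ti] [t1 t2]]] := filter_ex (filterI (filterI (Uf y z) hi)
    (filterI (esc (DL_fst y) (DL_fst z)) (esc' (DL_snd y) (DL_snd z)))).
  rewrite ft !(DL_distE hT hT' hk hk') !rho_levelE -!intrB /horo_product_dist ti.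
  by congr (_%:~R); rewrite t1 t2; lia.
Qed.

End Classification.

Lemma meet_max (k : nat) (T : marked_graph) (hT : is_marked_regular_tree k T) (u v : T) :
  - 2 * height (meet u v) - `|height u - height v| =
  (tdist u v)%:Z - 2 * Num.max (height u) (height v).
Proof. by rewrite (tdist_height hT); lia. Qed.

Theorem proposition6p3 (R : realType) (p q : nat) (T T' : marked_graph)
    (hp : (2 <= p)%N) (hq : (2 <= q)%N)
    (hT : is_marked_regular_tree p.+1 T)
    (hT' : is_marked_regular_tree q.+1 T') :
  [/\ (forall (x0 : T) (y : DL T T'),
         rho_vertex R x0 y =
         ((tdist (val y).1 x0)%:Z
          - 2 * Num.max (height (val y).1) (height x0))%:~R),
      (forall (x0' : T') (y : DL T T'),
         rho_vertex' R x0' y =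
         ((tdist (val y).2 x0')%:Z
          - 2 * Num.max (height (val y).2) (height x0'))%:~R),
      (forall (i : int) (y : DL T T'),
         rho_level R i y = (- `|height (val y).2 + i|)%:~R),
      DL_horofunctions R T T' `<=` lipschitz1 (DL_dist R T T') &
      horoboundary (DL_dist R T T') =
      cst_classes (DL_dist R T T') (DL_horofunctions R T T')].
Proof.
have conn := DL_connected hT hT' hp hq.
have dC x y : DL_dist R T T' x y = DL_dist R T T' y x.
  by rewrite /DL_dist (gdistC (DL_adj_sym hT hT') conn).
have d_tri x y z : DL_dist R T T' x z <= DL_dist R T T' x y + DL_dist R T T' y z.
  by rewrite /DL_dist -natrD ler_nat (gdist_triangle conn).
have Hlim := horofunction_limit hT hT' hp hq.
split=> [x0 y|x0' y|i y|f /Hlim|].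
- by rewrite /rho_vertex (meet_max hT).
- by rewrite /rho_vertex' (meet_max hT').
- rewrite rho_levelE -[height (val y).2]/(height (DL_snd y)); congr (_%:~R).
  by have := DL_height y; lia.
- exact: limit_function_lipschitz.
- apply: horoboundary_eq => //; first by move=> x y; eexists.
  + by move=> f /Hlim.
  + exact: (limit_function_classification hT hT' hp hq).
  + by move=> f x c; exact: (horofunction_not_distance hT hT' hp hq).
Qed.
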